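(* The following statements are equivalent. (i) Problem (P1$'$) (stated in the context) is convex in $f$. (ii) For any $f\in\mathcal U_c^{\rm F}$, $$\mathbb E\int_0^T\Big(-\mathbf y^T\hat{\mathbf Q}\mathbf y+Nf^TR_2f\Big)dt-\mathbb E\|\mathbf y(T)\|_{\mathbf H}^2\ge0,$$ where $\mathbf y\in\mathbb R^{nN}$ satisfies $d\mathbf y=(\check{\mathbf A}\mathbf y+\mathbf 1\otimes f)dt$, $\mathbf y(0)=0$. (iii) For any $f\in\mathcal U_c^{\rm F}$, $$\mathbb E\int_0^T\Big\{-\|(I-\Gamma)y_i\|_Q^2+\|f\|_{R_2}^2\Big\}dt-\mathbb E\|y_i(T)\|_H^2\ge0,$$ where, for $i=1,\dots,N$, $y_i$ satisfies $dy_i=[Ay_i+Gy^{(N)}+f]dt$, $y_i(0)=0$, with $y^{(N)}=\frac1N\sum_{j=1}^Ny_j$.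
   Context: **Model.** Fix $T>0$, $N\ge1$, $A,G,\Gamma\in\mathbb R^{n\times n}$, $B\in\mathbb R^{n\times r}$, $\sigma\in\mathbb R^{n\times d}$, $\eta\in\mathbb R^n$, symmetric $Q,R_2,H\in\mathbb R^{n\times n}$ with $Q\ge0$, $R_2>0$, $H\ge0$. Agent $i$, $1\le i\le N$, satisfies $$dx_i=[Ax_i+B\check u_i+Gx^{(N)}+f]dt+\sigma dW_i,\quad x_i(0)=x_{i0},\qquad x^{(N)}=\frac1N\sum_{j=1}^Nx_j,$$ with mutually independent $d$-dimensional Brownian motions $W_i$, independent of the independent square-integrable initial states $x_{i0}$ which have a common mean. $\mathcal U_c^{\rm F}$ is the set of processes ($\mathbb R^r$-valued for controls, $\mathbb R^n$-valued for $f$) adapted to $\sigma(x_i(0),W_i(s),0\le s\le t,1\le i\le N)$ with $\mathbb E\int_0^T\|\cdot\|^2dt<\infty$. The controls $\check u_i\in\mathcal U_c^{\rm F}$ are fixed. $\|z\|_M^2=z^TMz$. **Problem (P1$'$):** minimize over $f\in\mathcal U_c^{\rm F}$ $$\check J_{\rm soc}^{\rm F}(f)=\frac12\sum_{i=1}^N\Big(\mathbb E\int_0^T\{-\|x_i-\Gamma x^{(N)}-\eta\|_Q^2+\|f\|_{R_2}^2\}dt-\mathbb E\|x_i(T)\|_H^2\Big).$$ **Notation.** $\Psi=\Gamma^TQ+Q\Gamma-\Gamma^TQ\Gamma$; $\mathbf 1=(1,\dots,1)^T\in\mathbb R^N$; $\otimes$ is the Kronecker product; $\hat{\mathbf Q}=\mathrm{diag}(Q,\dots,Q)-\frac1N\mathbf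 1\mathbf 1^T\otimes\Psi$; $\mathbf H=\mathrm{diag}(H,\dots,H)$; $\check{\mathbf A}=\mathrm{diag}(A,\dots,A)+\frac1N(\mathbf 1\mathbf 1^T\otimes G)$ ($N$ diagonal blocks each). *)

(* Defs.v *)
From HB Require Import structures.
From mathcomp Require Import all_boot all_order all_algebra.
From mathcomp Require Import mxtens.
From mathcomp Require Import all_classical all_reals all_analysis.

Set Implicit Arguments.
Unset Strict Implicit.
Unset Printing Implicit Defensive.

Import Order.TTheory GRing.Theory Num.Theory.
Import numFieldNormedType.Exports.

Local Open Scope classical_set_scope.
Local Open Scope ring_scope.

Definition qform (R : realType) m (M : 'M[R]_m) (z : 'cV[R]_m) : R :=
  (z^T *m M *m z) 0 0.

Definition possemidef (R : realType) m (M : 'M[R]_m) : Prop :=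
  M^T = M /\ forall z : 'cV[R]_m, 0 <= qform M z.

Definition posdef (R : realType) m (M : 'M[R]_m) : Prop :=
  M^T = M /\ forall z : 'cV[R]_m, z != 0 -> 0 < qform M z.

(* 'cV_(N * n) is R^{nN} stacked in N blocks of length n: index a is the
   entry (mxtens_unindex a).2 of block (mxtens_unindex a).1, the indexing
   used by the Kronecker product *t of mxtens. *)
Definition blkdiag (R : realType) N n (M : 'M[R]_n) : 'M[R]_(N * n) :=
  \matrix_(a, b)
    if (mxtens_unindex a).1 == (mxtens_unindex b).1
    then M (mxtens_unindex a).2 (mxtens_unindex b).2 else 0.

Definition ones (R : realType) N : 'cV[R]_N := const_mx 1.

Definition Psi (R : realType) n (Q Gam : 'M[R]_n) : 'M[R]_n :=
  Gam^T *m Q + Q *m Gam - Gam^T *m Q *m Gam.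

Definition Qhat (R : realType) N n (Q Gam : 'M[R]_n) : 'M[R]_(N * n) :=
  blkdiag N Q - N%:R^-1 *: ((ones R N *m (ones R N)^T) *t Psi Q Gam).

Definition Acheck (R : realType) N n (A G : 'M[R]_n) : 'M[R]_(N * n) :=
  blkdiag N A + N%:R^-1 *: ((ones R N *m (ones R N)^T) *t G).

(* 1 ⊗ z; the column dimension 1 * 1 of the Kronecker product reduces to 1. *)
Definition ones_tens (R : realType) N n (z : 'cV[R]_n) : 'cV[R]_(N * n) :=
  ones R N *t z.

Definition avg (R : realType) N n (z : 'I_N -> 'cV[R]_n) : 'cV[R]_n :=
  N%:R^-1 *: \sum_(j < N) z j.

Section probability.
Context (R : realType) (d : measure_display) (Omega : measurableType d)
  (P : probability Omega R).

(* Only the values at times t >= 0 (or 0 <= t <= T) are ever constrained. *)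
Definition process m := R -> Omega -> 'cV[R]_m.

Definition gens (I : Type) (D : set I) (X : I -> Omega -> R) :
    set_system Omega :=
  \bigcup_(i in D) preimage_set_system setT (X i) measurable.

Definition sigma_of (I : Type) (D : set I) (X : I -> Omega -> R) :
  set_system Omega := <<s gens D X >>.

(* Taking A i = setT shows that the product rule for full families entails it
   for every subfamily, when each F i is a sigma-algebra. *)
Definition indep_family (I : finType) (F : I -> set_system Omega) : Prop :=
  forall A : I -> set Omega, (forall i, F i (A i)) ->
    P (\bigcap_(i in [set: I]) A i) = (\prod_(i : I) P (A i))%E.

Definition incr (B : R -> Omega -> R) (s t : R) (w : Omega) : R :=
  B t w - B s w.

Definition brownian1 (B : R -> Omega -> R) : Prop :=
  [/\ forall t, 0 <= t -> measurable_fun setT (B t),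
      {ae P, forall w, B 0 w = 0},
      {ae P, forall w, {within `[0, +oo[, continuous (B ^~ w)}},
      forall s t, 0 <= s -> s < t -> forall C : set R, measurable C ->
        P (incr B s t @^-1` C)
          = normal_prob 0 (Num.sqrt (t - s)) C
    & forall s t, 0 <= s -> s < t ->
        forall E, sigma_of `[0, s] B E -> forall C : set R, measurable C ->
        P (E `&` incr B s t @^-1` C)
          = (P E * P (incr B s t @^-1` C))%E].

Definition brownian k (W : process k) : Prop :=
  (forall l : 'I_k, brownian1 (fun t w => W t w l 0)) /\
  indep_family (fun l : 'I_k => sigma_of `[0, +oo[ (fun t w => W t w l 0)).

Definition sigma_rv m (xi : Omega -> 'cV[R]_m) : set_system Omega :=
  sigma_of [set: 'I_m] (fun k w => xi w k 0).

Definition sigma_process m (X : process m) : set_system Omega :=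
  sigma_of [set p : R * 'I_m | 0 <= p.1] (fun p w => X p.1 w p.2 0).

(* Noises and initial states: mutual independence of the W_i, mutual
   independence of the x_i0, and independence of the former from the latter
   together mean joint independence of the 2N sigma-algebras below. *)
Definition noise_model N n k (x0 : 'I_N -> Omega -> 'cV[R]_n)
    (W : 'I_N -> process k) : Prop :=
  [/\ forall i, brownian (W i),
      forall i l, measurable_fun setT (fun w => x0 i w l 0),
      forall i, (\int[P]_w (qform 1%:M (x0 i w))%:E < +oo)%E,
      forall i j l, ('E_P[fun w => x0 i w l 0%R] = 'E_P[fun w => x0 j w l 0%R])%E
    & indep_family (fun s : 'I_N + 'I_N => match s with
        | inl i => sigma_rv (x0 i)
        | inr i => sigma_process (W i) end)].

Definition filtration N n k (x0 : 'I_N -> Omega -> 'cV[R]_n)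
    (W : 'I_N -> process k) (t : R) : set_system Omega :=
  <<s gens [set: 'I_N * 'I_n] (fun p w => x0 p.1 w p.2 0) `|`
      gens [set p : R * ('I_N * 'I_k) | 0 <= p.1 <= t]
           (fun p w => W p.2.1 p.1 w p.2.2 0) >>.

Definition jmeasurable (T : R) m (X : process m) : Prop :=
  forall l, measurable_fun (`[0, T] `*` [set: Omega])
    (fun z : R * Omega => X z.1 z.2 l 0).

Definition adapted (T : R) (F : R -> set_system Omega) m (X : process m) :
    Prop :=
  forall t, 0 <= t <= T -> forall l,
    preimage_set_system setT (fun w => X t w l 0) measurable `<=` F t.

Definition Eint (T : R) (g : R -> Omega -> R) : \bar R :=
  (\int[P]_w \int[lebesgue_measure]_(t in `[0%R, T]) (g t w)%:E)%E.

(* U_c^F for processes with values in R^m. *)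
Definition admissible (T : R) N n k (x0 : 'I_N -> Omega -> 'cV[R]_n)
    (W : 'I_N -> process k) m : set (process m) :=
  [set f | [/\ jmeasurable T f, adapted T (filtration x0 W) f
             & (Eint T (fun t w => qform 1%:M (f t w)) < +oo)%E]].

Definition vint m (t : R) (g : R -> 'cV[R]_m) : 'cV[R]_m :=
  \col_l Rintegral lebesgue_measure `[0, t] (fun s => g s l 0).

(* dX = b dt + dM on [0, T] with X(0) = xi, for M(0) = 0.  As the noise
   coefficient of the model is constant, the stochastic integral is just
   sigma W(t) and the equation is understood pathwise. *)
Definition solves (T : R) m (xi : Omega -> 'cV[R]_m) (b M X : process m) :
    Prop :=
  jmeasurable T X /\
  {ae P, forall w,
    (forall l, {within `[0, T], continuous (fun t => X t w l 0)}) /\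
    (forall t, 0 <= t <= T -> X t w = xi w + vint t (b ^~ w) + M t w)}.

Definition is_state (T : R) N n r k (A G : 'M[R]_n) (B : 'M[R]_(n, r))
    (sigma : 'M[R]_(n, k)) (x0 : 'I_N -> Omega -> 'cV[R]_n)
    (W : 'I_N -> process k) (u : 'I_N -> process r) (f : process n)
    (x : 'I_N -> process n) : Prop :=
  forall i, solves T (x0 i)
    (fun t w => A *m x i t w + B *m u i t w
                + G *m avg (fun j => x j t w) + f t w)
    (fun t w => sigma *m W i t w)
    (x i).

(* For noise and admissible inputs as in the model, the set below is nonempty
   and any two of its elements are indistinguishable on [0, T]. *)
Definition state (T : R) N n r k (A G : 'M[R]_n) (B : 'M[R]_(n, r))
    (sigma : 'M[R]_(n, k)) (x0 : 'I_N -> Omega -> 'cV[R]_n)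
    (W : 'I_N -> process k) (u : 'I_N -> process r) (f : process n) :
    'I_N -> process n :=
  xget (fun _ _ _ => 0) [set x | is_state T A G B sigma x0 W u f x].

Definition Jsoc (T : R) N n r k (A G Gam : 'M[R]_n) (B : 'M[R]_(n, r))
    (sigma : 'M[R]_(n, k)) (eta : 'cV[R]_n) (Q R2 H : 'M[R]_n)
    (x0 : 'I_N -> Omega -> 'cV[R]_n) (W : 'I_N -> process k)
    (u : 'I_N -> process r) (f : process n) : \bar R :=
  let x := state T A G B sigma x0 W u f in
  ((2^-1)%:E * \sum_(i < N)
    (Eint T (fun t w =>
       - qform Q (x i t w - Gam *m avg (fun j => x j t w) - eta)
       + qform R2 (f t w))%R
     - \int[P]_w (qform H (x i T w))%:E))%E.

Definition convex_functional m (U : set (process m)) (J : process m -> \bar R) :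
    Prop :=
  forall f g, U f -> U g -> forall lam : R, 0 <= lam <= 1 ->
    (J (fun t w => lam *: f t w + (1 - lam) *: g t w)%R
       <= lam%:E * J f + (1 - lam)%:E * J g)%E.

End probability.

(* Main.v *)
Require Import Defs.
From mathcomp Require Import all_boot all_order all_algebra.
From mathcomp Require Import mxtens ring lra.
From mathcomp Require Import all_classical all_reals all_analysis.
From mathcomp Require Import measurable_realfun.

(* All three statements are equivalent to the nonnegativity, for every
   admissible [f], of the defect
     E int_0^T (- |(I - Gam) z|_Q^2 + |f|_R2^2) dt - E |z(T)|_H^2
   where dz = ((A + G) z + f) dt, z(0) = 0.  In the homogeneous systems of (ii)
   and (iii) two agents differ by a solution of dD = A D dt, D(0) = 0, so all
   agents coincide almost surely with such a [z].  For (i), states depend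
   affinely on the input: the state for a mixture of [f] and [g] is the mixture
   of the states, and the states for [f] and [g] differ, for every agent, by
   the [z] of [f - g].  The cost being quadratic, the convexity gap at weight
   lam is lam (1 - lam) N / 2 times the defect of [f - g].  This needs the
   states to exist (Picard iteration along paths, which also gives joint
   measurability) and the costs to be finite (Gronwall along paths and the
   second moment of Brownian motion). *)

Set Implicit Arguments.
Unset Strict Implicit.
Unset Printing Implicit Defensive.

Import Order.TTheory GRing.Theory Num.Theory.
Import numFieldNormedType.Exports.

Local Open Scope classical_set_scope.
Local Open Scope ring_scope.

(** * Linear integral equations along paths *)

Section paths.
Context (R : realType).
Local Notation leb := (@lebesgue_measure R).
Implicit Types (g v : R -> R) (c C B L T t : R).

(** The algebra is short; the obstacle is analytic. [state] is a choice with a default value and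
    [Jsoc] is an extended real, so nothing can be computed before states are known to exist and all
    terms to be finite. Moreover the equations hold only almost surely, whereas joint measurability
    of a limit asks for good behaviour on every path. The data are therefore cut off by the
    indicator of a measurable almost sure event, and the results are carried back by almost sure
    equality at all times simultaneously. Every equation becomes, on a single path, a Volterra
    equation X = h + int K X. Its constants depend on [K] and the horizon only, so that pathwise
    bounds can be squared and integrated over the sample space. The same defect appears for every
    agent because initial states, controls, noise and [eta] cancel in a difference of states,
    leaving (I - Gam) z in the running cost. To recover the defect of a given f from convexity, take
    g = 0 and the weight 1/2. *)

Lemma within_continuousM (A : set R) g v : {within A, continuous g} ->
  {within A, continuous v} -> {within A, continuous (fun s => g s * v s)}.
Proof.
by move=> cg cv x; apply: (@continuousM _ (subspace A) g v x);
  [exact: cg|exact: cv].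
Qed.

Lemma within_continuous_sum (A : set R) (I : Type) (r : seq I)
    (F : I -> R -> R) : (forall i, {within A, continuous (F i)}) ->
  {within A, continuous (fun s => \sum_(i <- r) F i s)}.
Proof.
move=> cF x; apply: cvg_big => [|i _]; last exact: cF.
exact: add_continuous.
Qed.

Lemma continuous_integrable T t g : {within `[0, T], continuous g} ->
  t <= T -> leb.-integrable `[0, t] (EFin \o g).
Proof.
move=> cg tT; apply: (@integrableS _ _ _ leb `[0, T]) => //.
  by apply: subset_itvl; rewrite bnd_simp.
by apply: continuous_compact_integrable => //; exact: segment_compact.
Qed.

Lemma integral_expR c t : 0 < c -> 0 <= t ->
  leb.-integrable `[0, t] (EFin \o (fun s => expR (c * s))) /\
  \int[leb]_(s in `[0, t]) expR (c * s) = (expR (c * t) - 1) / c.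
Proof.
move=> c0 t0.
have cE : continuous (fun s : R => expR (c * s)).
  move=> s; apply: (@continuous_comp _ _ _ (fun s => c * s) expR).
    by apply: continuousM; [exact: cvg_cst|exact: cvg_id].
  exact: continuous_expR.
split.
  apply: continuous_compact_integrable; first exact: segment_compact.
  exact: continuous_subspaceT.
(* The fundamental theorem of calculus is applied on nondegenerate intervals, so t = 0 is settled
   separately. *)
move: t0; rewrite le_eqVlt => /predU1P[<-|t0].
  by rewrite set_itv1 Rintegral_set1 mulr0 expR0 subrr mul0r.
have dE (x : R) : is_derive x 1 (fun s : R => c^-1 * expR (c * s)) (expR (c * x)).
  apply: is_derive_eq; rewrite /GRing.scale /=.
  by rewrite !(mulr0, mul0r, addr0, mulr1) mulrCA mulVf ?mulr1 ?gt_eqF.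
have dcont : continuous (fun s : R => c^-1 * expR (c * s)).
  by move=> x; apply: differentiable_continuous; apply/derivable1_diffP; exact: ex_derive.
rewrite /Rintegral (@continuous_FTC2 R _ (fun s => c^-1 * expR (c * s))) //.
- by rewrite /= mulr0 expR0; field; rewrite gt_eqF.
- exact: continuous_subspaceT.
- split.
  + by move=> x _; exact: ex_derive.
  + apply: cvg_at_right_filter; exact: dcont.
  + apply: cvg_at_left_filter; exact: dcont.
- by move=> x _; rewrite derive1E; exact: derive_val.
Qed.

(** Integrating under the weight exp (c s) gains a factor 1 / c; every contraction below comes from
    taking c large. *)
Lemma le_integral_expR c C t g : 0 < c -> 0 <= C -> 0 <= t ->
  leb.-integrable `[0, t] (EFin \o g) ->
  (forall s, 0 <= s <= t -> g s <= C * expR (c * s)) ->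
  \int[leb]_(s in `[0, t]) g s <= C / c * expR (c * t).
Proof.
move=> c0 C0 t0 ig gC.
have [ie ve] := integral_expR c0 t0.
apply: (@le_trans _ _ (\int[leb]_(s in `[0, t]) (C * expR (c * s)))).
  apply: le_Rintegral => //=.
    have -> : EFin \o (fun s => C * expR (c * s)) =
       (fun s => C%:E * (EFin \o (fun s => expR (c * s))) s)%E.
      by apply/funext => s /=; rewrite EFinM.
    exact: integrableZl.
rewrite RintegralZl // ve mulrA mulrAC ler_wpM2l ?divr_ge0 ?(ltW c0) //.
by rewrite lerBlDr lerDl.
Qed.

(* In the norm weighted by [exp (- c s)], [c = 2 (L + 1)], the integral operator
   contracts by [1/2], so the maximum [M] of the weighted [v] satisfies
   [M <= B + M / 2]; the same weight drives the Picard iteration below. *)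
Lemma gronwall T B L v : 0 <= B -> 0 <= L -> 0 <= T ->
  {within `[0, T], continuous v} ->
  (forall t, 0 <= t <= T -> 0 <= v t <= B + L * \int[leb]_(s in `[0, t]) v s) ->
  forall t, 0 <= t <= T -> v t <= 2 * B * expR (2 * (L + 1) * t).
Proof.
move=> B0 L0 T0 cv vB.
set c := 2 * (L + 1).
have c0 : 0 < c by rewrite /c mulr_gt0 // ltr_wpDl.
have cw : {within `[0, T], continuous (fun s => v s * expR (- (c * s)))}.
  apply: within_continuousM => //.
  apply: continuous_subspaceT => {}s.
  apply: (@continuous_comp _ _ _ (fun s => - (c * s)) expR).
    by apply: continuousN; apply: continuousM; [exact: cvg_cst|exact: cvg_id].
  exact: continuous_expR.
have [a] := EVT_max T0 cw.
rewrite in_itv /= => aT aM.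
set M := v a * expR (- (c * a)) in aM.
have Ec s : expR (- (c * s)) * expR (c * s) = 1 by rewrite -expRD addNr expR0.
have vM s : 0 <= s <= T -> v s <= M * expR (c * s).
  move=> sT; rewrite -[leLHS]mulr1 -(Ec s) mulrA ler_wpM2r ?expR_ge0 //.
  by apply: aM; rewrite in_itv.
have M0 : 0 <= M by rewrite mulr_ge0 ?expR_ge0 //; have /andP[] := vB _ aT.
have MB : M <= 2 * B.
  have /andP[a0 aT'] := aT; have /andP[_ va] := vB _ aT.
  have I : \int[leb]_(s in `[0, a]) v s <= M / c * expR (c * a).
    apply: le_integral_expR => //; first exact: continuous_integrable cv _.
    by move=> s /andP[s0 sa]; apply: vM; rewrite s0 (le_trans sa).
  have Ea : 0 < expR (c * a) by exact: expR_gt0.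
  have E1 : 1 <= expR (c * a).
    by rewrite -expR0 ler_expR mulr_ge0 // ltW.
  have vE : v a = M * expR (c * a) by rewrite /M -mulrA Ec mulr1.
  have LI : L * \int[leb]_(s in `[0, a]) v s <= M / 2 * expR (c * a).
    apply: (le_trans (ler_wpM2l L0 I)).
    rewrite mulrA ler_wpM2r ?(ltW Ea) // mulrCA ler_wpM2l //.
    by rewrite ler_pdivrMr // /c mulrA mulVf // mul1r lerDl.
  have : M / 2 * expR (c * a) <= B * expR (c * a).
    have BE : B <= B * expR (c * a) by rewrite ler_peMr.
    move: va; rewrite vE; lra.
  by rewrite ler_pM2r //; lra.
move=> t tT; apply: (le_trans (vM _ tT)).
by rewrite ler_wpM2r ?expR_ge0.
Qed.


Lemma cvg_half_pow C : (fun k => C / 2 ^+ k) @ \oo --> (0 : R).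
Proof.
rewrite (_ : (fun k => _) = geometric C 2^-1); last first.
  by apply/funext => k; rewrite /geometric /= exprVn.
by apply: cvg_geometric; rewrite ger0_norm ?invr_ge0 // invf_lt1 // ltr1n.
Qed.

(** Telescoping gives a Cauchy sequence, and the tail of the geometric series from k on is 2 C /
    2^k. The rate is kept because uniform convergence is read off from it. *)
Lemma geometric_cvg (u : nat -> R) C : 0 <= C ->
  (forall k, `|u k.+1 - u k| <= C / 2 ^+ k) ->
  exists l : R, u @ \oo --> l /\ forall k, `|l - u k| <= 2 * C / 2 ^+ k.
Proof.
move=> C0 uC.
(* The last factor makes the right side the exact partial geometric sum, so that the induction
   closes; [gap2] then drops it. *)
have gap k m : `|u (k + m)%N - u k| <= 2 * C / 2 ^+ k * (1 - (2 ^+ m)^-1).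
  elim: m => [|m IH]; first by rewrite addn0 subrr normr0 expr0 invr1 subrr mulr0.
  rewrite addnS -(subrK (u (k + m)%N) (u _.+1)) -addrA.
  apply: (le_trans (ler_normD _ _)); apply: (le_trans (lerD (uC _) IH)).
  rewrite exprD exprS le_eqVlt; apply/orP; left; apply/eqP.
  by field; rewrite !expf_neq0.
have gap2 k m : (k <= m)%N -> `|u m - u k| <= 2 * C / 2 ^+ k.
  move=> /subnKC <-; apply: (le_trans (gap _ _)).
  by rewrite ler_piMr ?divr_ge0 ?mulr_ge0 // ?exprn_ge0 // lerBlDr lerDl invr_ge0 exprn_ge0.
have geo0 := cvg_half_pow (2 * C).
have cu : cvgn u.
  apply/cauchy_cvgP/cauchy_exP => e e0.
  have /cvgrPdist_lt /(_ _ e0) [k _ kP] := geo0.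
  exists (u k); exists k => // m /= km; rewrite /ball /= distrC.
  apply: (le_lt_trans (gap2 _ _ km)).
  by have := kP k (leqnn k); rewrite /= sub0r normrN ger0_norm // divr_ge0 ?mulr_ge0 ?exprn_ge0.
exists (limn u); split=> // k.
apply: (@cvgr_to_le _ \oo _ _ (fun m => `|u m - u k|)).
  by apply: cvg_norm; apply: cvgB => //; exact: cvg_cst.
by exists k => // m /= km; exact: gap2.
Qed.


Lemma continuous_bounded T g : 0 <= T -> {within `[0, T], continuous g} ->
  exists2 C, 0 <= C & forall t, 0 <= t <= T -> `|g t| <= C.
Proof.
move=> T0 cg.
have cn : {within `[0, T], continuous (fun s => `|g s|)}.
  by move=> x; apply: cvg_norm; exact: cg.
have [a aT aM] := EVT_max T0 cn.
by exists `|g a| => // t tT; apply: aM; rewrite in_itv.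
Qed.

Lemma uniform_half_pow_continuous (A : set R) (u : nat -> R -> R) g C :
  (forall k, {within A, continuous (u k)}) ->
  (forall k t, A t -> `|g t - u k t| <= C / 2 ^+ k) ->
  {within A, continuous g}.
Proof.
move=> cu uC.
apply: (@uniform_limit_continuous_subspace _ _ A (u @ \oo)).
  by exists 0%N => // k _; exact: cu.
move=> P /uniform_nbhs[E [entE EP]]; apply: filterS EP _.
have /cvgrPdist_lt CE := cvg_half_pow C.
have [e /= e0 eE] : exists2 e : R, 0 < e & [set xy | ball xy.1 e xy.2] `<=` E.
  by move: entE; rewrite -entourage_from_ballE.
have [k _ kP] := CE _ e0; exists k => // j /= kj t At; apply: eE => /=.
rewrite /ball /=; apply: (le_lt_trans (uC _ _ At)).
by have := kP j kj; rewrite /= sub0r normrN; apply: le_lt_trans; exact: ler_norm.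
Qed.

(** * Volterra equations by Picard iteration: existence, a priori bound, uniqueness *)

Section volterra.
Variables (m : nat) (K : 'M[R]_m).
Implicit Types (h X Y : 'I_m -> R -> R).

Definition kint X (l : 'I_m) t : R :=
  \int[leb]_(s in `[0, t]) \sum_j K l j * X j s.

Fixpoint picard h k : 'I_m -> R -> R :=
  if k is k'.+1 then fun l t => h l t + kint (picard h k') l t else h.

(** An explicit limit of iterates instead of a chosen solution: measurability in a parameter passes
    from the iterates to it. *)
Definition volterra h l t : R := limn (fun k => picard h k l t).

(** The entrywise sum dominates every row sum, so one constant serves all components. *)
Let Knorm := \sum_i \sum_j `|K i j|.

Let Knorm_ge0 : 0 <= Knorm.
Proof. by do 2!apply: sumr_ge0 => ? _. Qed.

Lemma kint_continuous T X : 0 <= T -> (forall l, {within `[0, T], continuous (X l)}) ->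
  forall l, {within `[0, T], continuous (kint X l)}.
Proof.
move=> T0 cX l.
apply: (@parameterized_integral_continuous R 0 T (fun s => \sum_j K l j * X j s)) => //.
apply: continuous_integrable (lexx _).
apply: within_continuous_sum => j; apply: within_continuousM => //.
by move=> x; exact: cvg_cst.
Qed.

(** In the sup norm weighted by exp (- c t), [kint] is Lipschitz with constant Knorm / c. A large c
    makes it a contraction without restricting [T]. *)
Lemma kint_dist T c E X Y : 0 < c -> 0 <= E ->
  (forall l, {within `[0, T], continuous (X l)}) ->
  (forall l, {within `[0, T], continuous (Y l)}) ->
  (forall l t, 0 <= t <= T -> `|X l t - Y l t| <= E * expR (c * t)) ->
  forall l t, 0 <= t <= T ->
    `|kint X l t - kint Y l t| <= Knorm * E / c * expR (c * t).
Proof.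
move=> c0 E0 cX cY XY l t /andP[t0 tT].
have iK Z : (forall l, {within `[0, T], continuous (Z l)}) ->
    leb.-integrable `[0, t] (EFin \o (fun s => \sum_j K l j * Z j s)).
  move=> cZ; apply: continuous_integrable tT.
  apply: within_continuous_sum => j; apply: within_continuousM => //.
  by move=> x; exact: cvg_cst.
have iXY : leb.-integrable `[0, t]
    (EFin \o (fun s => \sum_j K l j * X j s - \sum_j K l j * Y j s)).
  have := integrableB (mu := leb) (D := `[0, t]) _ (iK _ cX) (iK _ cY).
  exact.
rewrite /kint -RintegralB //; [|exact: iK..].
apply: (le_trans (le_normr_Rintegral _ _)) => //.
apply: le_integral_expR => //; first exact: mulr_ge0.
  exact: integrable_norm.
move=> s /andP[s0 st]; rewrite -sumrB.
apply: (le_trans (ler_norm_sum _ _ _)).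
apply: (@le_trans _ _ ((\sum_j `|K l j|) * (E * expR (c * s)))).
  rewrite mulr_suml; apply: ler_sum => j _; rewrite -mulrBr normrM.
  by apply: ler_wpM2l => //; apply: XY; rewrite s0 (le_trans st).
rewrite -mulrA; apply: ler_wpM2r; first by rewrite mulr_ge0 ?expR_ge0.
rewrite /Knorm [leRHS](bigD1 l) //= lerDl.
by do 2!apply: sumr_ge0 => ? _.
Qed.

Lemma picard_continuous T h : 0 <= T -> (forall l, {within `[0, T], continuous (h l)}) ->
  forall k l, {within `[0, T], continuous (picard h k l)}.
Proof.
move=> T0 ch; elim=> [//|k IH] l /=.
by apply: within_continuousD => //; exact: kint_continuous.
Qed.

Lemma picard_dist T h : 0 <= T -> (forall l, {within `[0, T], continuous (h l)}) ->
  exists2 C, 0 <= C & forall k l t, 0 <= t <= T ->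
    `|picard h k.+1 l t - picard h k l t| <= C / 2 ^+ k.
Proof.
(* This choice gives Knorm / c <= 1/2, whence the rate 1 / 2^k. *)
move=> T0 ch; pose c := 2 * (Knorm + 1).
have c0 : 0 < c by rewrite /c mulr_gt0 // ltr_wpDl.
have [M MP] : exists M : 'I_m -> R, forall l, 0 <= M l /\
    forall t, 0 <= t <= T -> `|kint h l t| <= M l.
  apply: (@fin_all_exists _ _ (fun l M => 0 <= M /\ forall t, 0 <= t <= T -> `|kint h l t| <= M)).
  by move=> l; have [M M0 MP] := continuous_bounded T0 (kint_continuous T0 ch (l:=l)); exists M.
(* Dominates the first increment [kint h] in all components at once. *)
pose C := \sum_l M l.
have C0 : 0 <= C by apply: sumr_ge0 => l _; have [] := MP l.
have D k l t : 0 <= t <= T ->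
    `|picard h k.+1 l t - picard h k l t| <= C / 2 ^+ k * expR (c * t).
  elim: k l t => [|k IH] l t tT.
    rewrite /= addrC addKr expr0 divr1; have /andP[t0 _] := tT.
    apply: (@le_trans _ _ C); last first.
      by rewrite ler_peMr // -expR0 ler_expR mulr_ge0 // ltW.
    rewrite /C (bigD1 l) //= -[leLHS]addr0 lerD ?sumr_ge0 // => [|i _].
      by have [_] := MP l; exact.
    by have [] := MP i.
  rewrite (_ : _ - _ = kint (picard h k.+1) l t - kint (picard h k) l t); last first.
    by rewrite /= opprD addrACA subrr add0r.
  have := @kint_dist T c (C / 2 ^+ k) (picard h k.+1) (picard h k) c0.
  move=> /(_ _ _ _ IH l t tT) /le_trans; apply => //.
  - by rewrite divr_ge0 // exprn_ge0.
  - exact: picard_continuous.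
  - exact: picard_continuous.
  apply: ler_wpM2r; first exact: expR_ge0.
  rewrite (_ : _ / c = C / 2 ^+ k * (Knorm / c)); last by ring.
  rewrite (_ : C / 2 ^+ k.+1 = C / 2 ^+ k * 2^-1); last first.
    by rewrite exprS invfM; ring.
  rewrite ler_wpM2l ?divr_ge0 ?exprn_ge0 // ler_pdivrMr // /c mulrA mulVf // mul1r.
  by rewrite lerDl.
(* The weight is removed by its maximum on [0, T]. *)
exists (C * expR (c * T)); first by rewrite mulr_ge0 ?expR_ge0.
move=> k l t tT; apply: (le_trans (D _ _ _ tT)).
rewrite mulrAC ler_wpM2r ?invr_ge0 ?exprn_ge0 // ler_wpM2l // ler_expR.
by have /andP[_ ?] := tT; rewrite ler_wpM2l // ltW.
Qed.

Lemma volterra_cvg T h : 0 <= T -> (forall l, {within `[0, T], continuous (h l)}) ->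
  exists2 C, 0 <= C & forall l t, 0 <= t <= T ->
    (fun k => picard h k l t) @ \oo --> volterra h l t /\
    forall k, `|volterra h l t - picard h k l t| <= C / 2 ^+ k.
Proof.
move=> T0 ch; have [C C0 CP] := picard_dist T0 ch.
exists (2 * C); first by rewrite mulr_ge0.
move=> l t tT; have [y [yP yk]] := geometric_cvg C0 (fun k => CP k l t tT).
have -> : volterra h l t = y by exact: cvg_lim.
by [].
Qed.

Lemma volterra_continuous T h : 0 <= T -> (forall l, {within `[0, T], continuous (h l)}) ->
  forall l, {within `[0, T], continuous (volterra h l)}.
Proof.
move=> T0 ch l; have [C C0 CP] := volterra_cvg T0 ch.
apply: (@uniform_half_pow_continuous _ (fun k => picard h k l) _ C) => [k|k t].
  exact: picard_continuous.
by rewrite /= in_itv /= => tT; have [_] := CP l t tT; exact.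
Qed.

(** No limit is taken under the integral: the residual of the equation is shown to be at most a
    constant over 2^k for every k, hence zero. *)
Lemma volterraE T h : 0 <= T -> (forall l, {within `[0, T], continuous (h l)}) ->
  forall l t, 0 <= t <= T -> volterra h l t = h l t + kint (volterra h) l t.
Proof.
move=> T0 ch l t tT; have [C C0 CP] := volterra_cvg T0 ch.
apply/eqP; rewrite -subr_eq0 -normr_le0.
have cv := volterra_continuous T0 ch.
(* The term [C] is the distance from the limit to iterate k.+1. The other term is the distance
   between the integral terms of iterate k and of the limit, from [kint_dist] with c = 1. *)
have D k : `|volterra h l t - (h l t + kint (volterra h) l t)| <=
   (C + Knorm * C * expR T) / 2 ^+ k.
  rewrite -(subrK (picard h k.+1 l t) (volterra h l t)) -addrA.
  apply: (le_trans (ler_normD _ _)); rewrite mulrDl; apply: lerD.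
    have [_ /(_ k.+1)] := CP l t tT; move/le_trans; apply.
    rewrite ler_wpM2l // lef_pV2 ?posrE ?exprn_gt0 // ler_weXn2l ?ler1n //.
  rewrite (_ : _ - _ = kint (picard h k) l t - kint (volterra h) l t); last first.
    by rewrite /= opprD addrACA subrr add0r.
  apply: (le_trans (@kint_dist T 1 (C / 2 ^+ k) _ _ _ _ _ _ _ l t tT)) => //.
  - by rewrite divr_ge0 ?exprn_ge0.
  - exact: picard_continuous.
  - move=> j s sT; rewrite distrC; have [_ /(_ k)] := CP j s sT; move/le_trans; apply.
    rewrite ler_peMr ?divr_ge0 ?exprn_ge0 // mul1r -expR0 ler_expR.
    by have /andP[] := sT.
  rewrite divr1 mul1r mulrA [leRHS]mulrAC ler_wpM2l ?divr_ge0 ?mulr_ge0 ?exprn_ge0 //.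
  by rewrite ler_expR; have /andP[] := tT.
apply: (@cvgr_to_ge _ \oo _ _ (fun k => (C + Knorm * C * expR T) / 2 ^+ k)).
  exact: cvg_half_pow.
by exists 0%N => // k _; exact: D.
Qed.

(** The order of quantifiers matters: the constant is chosen before [h] and [X], so along random
    paths it is deterministic and moments can be taken. *)
Lemma volterra_bound T : 0 <= T -> exists2 C, 0 <= C & forall h X,
  (forall l, {within `[0, T], continuous (h l)}) ->
  (forall l, {within `[0, T], continuous (X l)}) ->
  (forall l t, 0 <= t <= T -> X l t = h l t + kint X l t) ->
  forall l t, 0 <= t <= T ->
    `|X l t| <= `|h l t| + C * \int[leb]_(s in `[0, T]) \sum_j `|h j s|.
Proof.
(* Adding the componentwise bounds over the m components multiplies [Knorm] by m. *)
move=> T0; pose L := \sum_(l < m) Knorm.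
have L0 : 0 <= L by exact: sumr_ge0.
exists (Knorm * (2 * expR (2 * (L + 1) * T))); first by rewrite mulr_ge0 // mulr_ge0 ?expR_ge0.
move=> h X ch cX XE.
have cnorm Y : (forall l, {within `[0, T], continuous (Y l)}) ->
    {within `[0, T], continuous (fun s => \sum_j `|Y j s|)}.
  by move=> cY; apply: within_continuous_sum => j x; apply: cvg_norm; exact: cY.
(* Gronwall is applied to the integrated norm rather than to the norm of [X]: the forcing [h] then
   enters only through its integral [B], a constant. *)
pose v t := \int[leb]_(s in `[0, t]) \sum_j `|X j s|.
pose B := \int[leb]_(s in `[0, T]) \sum_j `|h j s|.
have ih := continuous_integrable (cnorm _ ch).
have iX := continuous_integrable (cnorm _ cX).
have B0 : 0 <= B by apply: Rintegral_ge0 => s _; exact: sumr_ge0.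
have cv : {within `[0, T], continuous v}.
  apply: (@parameterized_integral_continuous R 0 T (fun s => \sum_j `|X j s|)) => //.
  exact: iX.
have v0 t : 0 <= v t by apply: Rintegral_ge0 => s _; exact: sumr_ge0.
have Xv l t : 0 <= t <= T -> `|X l t| <= `|h l t| + Knorm * v t.
  move=> /andP[t0 tT]; rewrite XE ?t0 //; apply: (le_trans (ler_normD _ _)).
  rewrite lerD2l /kint.
  have iK : leb.-integrable `[0, t] (EFin \o (fun s => \sum_j K l j * X j s)).
    apply: continuous_integrable tT.
    apply: within_continuous_sum => j; apply: within_continuousM => //.
    by move=> x; exact: cvg_cst.
  apply: (le_trans (le_normr_Rintegral _ _)) => //.
  rewrite -RintegralZl //; last exact: iX.
  apply: le_Rintegral => //=.
  - exact: integrable_norm.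
  - have := integrableZl (mu := leb) (D := `[0, t]) _ Knorm (iX _ tT).
    exact.
  move=> s _; apply: (le_trans (ler_norm_sum _ _ _)).
  rewrite mulr_sumr; apply: ler_sum => j _; rewrite normrM ler_wpM2r //.
  rewrite /Knorm (bigD1 l) //= (bigD1 j) //= -addrA lerDl addr_ge0 ?sumr_ge0 // => i _.
  exact: sumr_ge0.
have vB t : 0 <= t <= T -> 0 <= v t <= B + L * \int[leb]_(s in `[0, t]) v s.
  move=> /andP[t0 tT]; rewrite v0 /=.
  have iv : leb.-integrable `[0, t] (EFin \o v) by exact: continuous_integrable cv tT.
  have iLv : leb.-integrable `[0, t] (EFin \o (fun s => L * v s)).
    have := integrableZl (mu := leb) (D := `[0, t]) _ L iv.
    exact.
  apply: (@le_trans _ _ (\int[leb]_(s in `[0, t]) (\sum_j `|h j s| + L * v s))).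
    apply: le_Rintegral => //=; first exact: iX.
      have := integrableD (mu := leb) (D := `[0, t]) _ (ih _ tT) iLv.
      exact.
    move=> s /=; rewrite in_itv /= => /andP[s0 st].
    rewrite /L mulr_suml -big_split /=; apply: ler_sum => j _.
    by apply: Xv; rewrite s0 (le_trans st).
  rewrite RintegralD //; last exact: ih.
  rewrite RintegralZl // lerD2r.
  rewrite /Rintegral; apply: fine_le.
  - by apply: integrable_fin_num => //; exact: ih.
  - by apply: integrable_fin_num => //; exact: ih.
  apply: ge0_subset_integral => //.
  - by have /integrableP[] := ih _ (lexx T).
  - by move=> s _; rewrite lee_fin sumr_ge0.
  - by apply: subset_itvl; rewrite bnd_simp.
move=> l t tT; apply: (le_trans (Xv _ _ tT)).
rewrite lerD2l -[leRHS]mulrA; apply: ler_wpM2l => //.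
apply: (le_trans (gronwall B0 L0 T0 cv vB tT)).
rewrite mulrAC; apply: ler_wpM2r => //; apply: ler_wpM2l => //.
rewrite ler_expR; apply: ler_wpM2l; first by rewrite mulr_ge0 ?addr_ge0.
by have /andP[] := tT.
Qed.

Lemma volterra_unique T X : 0 <= T -> (forall l, {within `[0, T], continuous (X l)}) ->
  (forall l t, 0 <= t <= T -> X l t = kint X l t) ->
  forall l t, 0 <= t <= T -> X l t = 0.
Proof.
move=> T0 cX XE l t tT; have [C C0 CP] := volterra_bound T0.
have c0 (j : 'I_m) : {within `[0, T], continuous (fun _ : R => 0 : R)}.
  by move=> x; exact: cvg_cst.
have XE0 j s : 0 <= s <= T -> X j s = 0 + kint X j s by move=> sT; rewrite add0r XE.
have := CP (fun _ _ => 0) X c0 cX XE0 l t tT.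
rewrite normr0 add0r (_ : Rintegral _ _ _ = 0).
  by rewrite mulr0 normr_le0 => /eqP.
transitivity (\int[leb]_(s in `[0, T]) (0 : R)).
  by apply: eq_Rintegral => s _; rewrite big1 // => j _; rewrite normr0.
by rewrite Rintegral_cst // mul0r.
Qed.

End volterra.

End paths.

(** * Joint measurability *)

Section joint_measurability.
Context (R : realType) (d : measure_display) (Omega : measurableType d).
Local Notation leb := (@lebesgue_measure R).
Implicit Types (g : R -> Omega -> R) (T t : R).

Definition jm T g := measurable_fun (`[0, T] `*` [set: Omega])
  (fun z : R * Omega => g z.1 z.2).

Lemma measurable_cylinder T : measurable (`[0, T] `*` [set: Omega] : set (R * Omega)).
Proof. by apply: measurableX. Qed.

Lemma jm_section T g t : jm T g -> 0 <= t <= T -> measurable_fun setT (g t).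
Proof.
move=> mg tT; apply: (@measurable_comp _ _ _ _ _ _ (`[0, T] `*` [set: Omega])
  (fun z : R * Omega => g z.1 z.2) setT (fun w => (t, w))) => //.
- exact: measurable_cylinder.
- by move=> _ [w _ <-] /=; rewrite in_itv /=.
- exact: pair1_measurable.
Qed.

(** Freezing time at the grid point below t gives a function that is measurable on each of countably
    many strips; path continuity makes these functions converge pointwise as the grid is refined. *)
Lemma caratheodory T g : (forall t, 0 <= t <= T -> measurable_fun setT (g t)) ->
  (forall w, {within `[0, T], continuous (g ^~ w)}) -> jm T g.
Proof.
move=> mg cg.
(* [s k t] rounds [t] down to the grid of step [1 / k.+1]. *)
pose s (k : nat) (t : R) : R := (Num.truncn (t * k.+1%:R))%:R / k.+1%:R.
have sP k t : 0 <= t <= T -> 0 <= s k t <= T /\ `|t - s k t| <= k.+1%:R^-1.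
  move=> /andP[t0 tT]; have k0 : 0 < k.+1%:R :> R by [].
  have /truncn_itv /andP[A B] : 0 <= t * k.+1%:R by rewrite mulr_ge0.
  have st : s k t <= t by rewrite /s ler_pdivrMr.
  split; first by rewrite /s divr_ge0 //= (le_trans st).
  rewrite ger0_norm ?subr_ge0 // lerBlDl /s -[X in _ + X]mul1r -mulrDl.
  by rewrite ler_pdivlMr // natr1 ltW.
apply: (@measurable_fun_cvg _ _ _ _
  (fun k (z : R * Omega) => g (s k z.1) z.2)); last first.
  move=> [t w] [/= tT _]; rewrite in_itv /= in tT.
  have /subspace_continuousP /(_ t) := cg w.
  rewrite /= in_itv /= => /(_ tT) /cvgrPdist_lt cgt.
  apply/cvgrPdist_lt => e e0; have [r /= r0 rP] := cgt _ e0.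
  have [k _ kP] : \forall k \near \oo, k.+1%:R^-1 < r.
    have := @cvg_harmonic R; move/cvgrPdist_lt => /(_ _ r0).
    by apply: filterS => k; rewrite /= sub0r normrN ger0_norm // invr_ge0.
  exists k => // j /= /kP jr; have [sj tj] := sP j t tT.
  by apply: rP => /=; [exact: le_lt_trans jr|rewrite in_itv].
move=> k.
(* On the strip over [I j] the rounded time is constant, equal to j / k.+1. *)
pose I (j : nat) : set R := `[0, T] `&` `[j%:R / k.+1%:R, j.+1%:R / k.+1%:R[.
have k0 : 0 < k.+1%:R :> R by [].
have -> : `[0, T] `*` [set: Omega] = \bigcup_j (I j `*` [set: Omega]).
  apply/seteqP; split=> [[t w] [/= tT _]|[t w] [j _ [[/= ? ?] _]]] //.
  have t0 : 0 <= t * k.+1%:R.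
    by move: tT; rewrite in_itv /= => /andP[t0 _]; rewrite mulr_ge0.
  exists (Num.truncn (t * k.+1%:R)) => //; split=> //; split => //=.
  by rewrite in_itv /= ler_pdivrMr // ltr_pdivlMr //; exact: truncn_itv.
apply/measurable_fun_bigcup => [j|j].
  by apply: measurableX => //; apply: measurableI.
(* Measurability of [g] at the grid point is only known up to [T]; beyond it the strip is empty. *)
have [jT|jT] := leP (j%:R / k.+1%:R) T; last first.
  rewrite (_ : _ `*` _ = set0); first exact: measurable_fun_set0.
  apply/seteqP; split=> // -[t w] [[/=]]; rewrite !in_itv /=.
  by move=> /andP[_ tT] /andP[/le_trans/(_ tT)]; rewrite leNgt jT.
apply: (@eq_measurable_fun _ _ _ _ _ (fun z : R * Omega => g (j%:R / k.+1%:R) z.2)).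
  move=> [t w]; rewrite inE => -[[/=]]; rewrite !in_itv /= => /andP[t0 _].
  rewrite ler_pdivrMr // ltr_pdivlMr // => tj _; congr (g _ w); congr (_%:R / _).
  by apply/esym/eqP; rewrite truncn_eq // mulr_ge0.
apply: measurable_funTS; apply: (@measurableT_comp _ _ _ _ _ _ (g (j%:R / k.+1%:R)) setT snd).
  by apply: mg; rewrite divr_ge0.
exact: measurable_snd.
Qed.

Lemma measurable_time_integral T (h : R * Omega -> \bar R) :
  measurable_fun (`[0, T] `*` [set: Omega]) h ->
  measurable_fun setT (fun w => \int[leb]_(s in `[0%R, T]) h (s, w))%E.
Proof.
move=> mh; pose D : set (R * Omega) := `[0, T] `*` [set: Omega].
have mD : measurable D by exact: measurable_cylinder.
(* Extension by zero to the whole product, followed by the splitting into positive and negative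
   parts, brings the claim under Tonelli. *)
pose H := h \_ D.
have mH : measurable_fun setT H.
  by apply/(measurable_restrict _ mD measurableT); rewrite setTI.
have -> : (fun w => \int[leb]_(s in `[0%R, T]) h (s, w))%E =
   ((fun w => \int[leb]_s H^\+ (s, w)) \- (fun w => \int[leb]_s H^\- (s, w)))%E.
  apply/funext => w; rewrite integral_mkcond integralE.
  rewrite (_ : patch _ _ _ = fun s => H (s, w)); last first.
    apply/funext => s; rewrite /H !patchE /D.
    by rewrite (_ : (s \in `[0, T]%classic) = ((s, w) \in D)) //; apply/idP/idP; rewrite !inE => //; case.
  by congr (_ - _)%E; apply: eq_integral => s _; rewrite ?funepos_comp ?funeneg_comp.
apply: emeasurable_funB.
- apply: (measurable_fun_fubini_tonelli_G (m1 := leb) (H^\+)%E) => //.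
  exact: measurable_funepos.
- apply: (measurable_fun_fubini_tonelli_G (m1 := leb) (H^\-)%E) => //.
  exact: measurable_funeneg.
Qed.

Lemma jmS T t g : t <= T -> jm T g -> jm t g.
Proof.
move=> tT; apply: measurable_funS; first exact: measurable_cylinder.
by move=> [s w] [/=]; rewrite !in_itv /= => /andP[-> /le_trans ->].
Qed.

Lemma measurable_time_Rintegral T t g : t <= T -> jm T g ->
  measurable_fun setT (fun w => \int[leb]_(s in `[0, t]) g s w).
Proof.
move=> tT mg; apply: (@measurableT_comp _ _ _ _ _ _ fine).
  exact: fine_measurable.
apply: (measurable_time_integral (h := fun z => (g z.1 z.2)%:E)).
by apply/measurable_EFinP; exact: jmS mg.
Qed.

Lemma jm_sum T (I : Type) (r : seq I) (F : I -> R -> Omega -> R) :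
  (forall i, jm T (F i)) -> jm T (fun t w => \sum_(i <- r) F i t w).
Proof.
move=> mF; rewrite /jm.
by apply: (@measurable_sum _ _ _ _ I r (fun i (z : R * Omega) => F i z.1 z.2)).
Qed.

(** By induction each iterate is jointly measurable: its integral term is measurable in w at fixed
    time and continuous in time, so [caratheodory] applies. The pointwise limit inherits this. *)
Lemma jm_volterra T m (K : 'M[R]_m) (h : 'I_m -> R -> Omega -> R) : 0 <= T ->
  (forall l, jm T (h l)) -> (forall l w, {within `[0, T], continuous (h l ^~ w)}) ->
  forall l, jm T (fun t w => volterra K (fun j s => h j s w) l t).
Proof.
move=> T0 mh ch l.
have mp k j : jm T (fun t w => picard K (fun j s => h j s w) k j t).
  elim: k j => [//|k IH] j.
  apply: (@measurable_funD _ _ _ _ (fun z => h j z.1 z.2)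
    (fun z => kint K (picard K (fun j s => h j s z.2) k) j z.1)); first exact: mh.
  have := @caratheodory T (fun t w => kint K (picard K (fun j s => h j s w) k) j t).
  apply.
    move=> t /andP[t0 tT]; apply: (measurable_time_Rintegral tT) => //.
    by apply: jm_sum => i; apply: measurable_funM => //; exact: IH.
  by move=> w; apply: kint_continuous => // i; exact: picard_continuous.
rewrite /jm.
apply: (@measurable_fun_cvg _ _ _ _
  (fun k (z : R * Omega) => picard K (fun j s => h j s z.2) k l z.1)).
  by move=> k; exact: mp.
move=> [t w] [/= tT _]; rewrite in_itv /= in tT.
by have [C _ /(_ l t tT)[]] := volterra_cvg K T0 (fun j => ch j w).
Qed.

End joint_measurability.

(** * Square integrability *)

Section square_integrable.
Context d (S : measurableType d) (R : realType) (mu : {measure set S -> \bar R}).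
Variables (D : set S) (mD : measurable D).
Implicit Types f g : S -> R.

Definition L1 f := mu.-integrable D (EFin \o f).

Definition L2 f := measurable_fun D f /\ L1 (fun x => f x ^+ 2).

Lemma L1_meas f : L1 f -> measurable_fun D f.
Proof. by move=> /integrableP[/measurable_EFinP]. Qed.

Lemma eq_L1 f g : (forall x, D x -> f x = g x) -> L1 f -> L1 g.
Proof. by move=> fg; apply: eq_integrable => // x; rewrite inE => /fg /= ->. Qed.

Lemma L1_le f g : measurable_fun D f -> L1 g ->
  (forall x, D x -> `|f x| <= g x) -> L1 f.
Proof.
move=> mf ig fg; apply: le_integrable ig => //; first exact/measurable_EFinP.
by move=> x Dx; rewrite lee_fin (le_trans (fg _ Dx)) // ler_norm.
Qed.

Lemma L1D f g : L1 f -> L1 g -> L1 (fun x => f x + g x).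
Proof.
move=> If Ig; have := integrableD mD If Ig.
exact.
Qed.

Lemma L1Z c f : L1 f -> L1 (fun x => c * f x).
Proof.
move=> If; have := integrableZl mD c If.
exact.
Qed.

Lemma L1_0 : L1 (fun=> 0).
Proof. exact: integrable0. Qed.

Lemma L1_sum (I : Type) (r : seq I) (F : I -> S -> R) : (forall i, L1 (F i)) ->
  L1 (fun x => \sum_(i <- r) F i x).
Proof.
move=> IF; elim: r => [|i r IH].
  by apply: eq_L1 L1_0 => x _; rewrite big_nil.
by apply: eq_L1 (L1D (IF i) IH) => x _; rewrite big_cons.
Qed.

Lemma L2_le f g : measurable_fun D f -> L1 g -> (forall x, D x -> f x ^+ 2 <= g x) -> L2 f.
Proof.
move=> mf Ig fg; split=> //; apply: (L1_le _ Ig).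
  exact: measurable_funX.
by move=> x Dx; rewrite ger0_norm ?sqr_ge0 // fg.
Qed.

Lemma eq_L2 f g : (forall x, D x -> f x = g x) -> L2 f -> L2 g.
Proof.
move=> fg [mf If]; split; last by apply: eq_L1 If => x /fg ->.
by apply: eq_measurable_fun mf => x; rewrite inE => /fg.
Qed.

Lemma L2D f g : L2 f -> L2 g -> L2 (fun x => f x + g x).
Proof.
move=> [mf If] [mg Ig]; apply: (@L2_le _ (fun x => 2 * f x ^+ 2 + 2 * g x ^+ 2)).
- exact: measurable_funD.
- by apply: L1D; exact: L1Z.
- move=> x _; rewrite -subr_ge0 (_ : _ - _ = (f x - g x) ^+ 2) ?sqr_ge0 //; ring.
Qed.

Lemma L2Z c f : L2 f -> L2 (fun x => c * f x).
Proof.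
move=> [mf If]; apply: (@L2_le _ (fun x => c ^+ 2 * f x ^+ 2)).
- exact: measurable_funM.
- exact: L1Z.
- by move=> x _; rewrite exprMn.
Qed.

Lemma L2_0 : L2 (fun=> 0).
Proof. by split=> //; apply: eq_L1 L1_0 => x _; rewrite expr0n. Qed.

Lemma L2_sum (I : Type) (r : seq I) (F : I -> S -> R) : (forall i, L2 (F i)) ->
  L2 (fun x => \sum_(i <- r) F i x).
Proof.
move=> IF; elim: r => [|i r IH].
  by apply: eq_L2 L2_0 => x _; rewrite big_nil.
by apply: eq_L2 (L2D (IF i) IH) => x _; rewrite big_cons.
Qed.

Lemma L2_mul f g : L2 f -> L2 g -> L1 (fun x => f x * g x).
Proof.
move=> [mf If] [mg Ig]; apply: (@L1_le _ (fun x => f x ^+ 2 + g x ^+ 2)).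
- exact: measurable_funM.
- exact: L1D.
- move=> x _; rewrite normrM -(real_normK (num_real (f x))) -(real_normK (num_real (g x))).
  have := sqr_ge0 (`|f x| - `|g x|); have := normr_ge0 (f x); have := normr_ge0 (g x).
  nra.
Qed.

Lemma L2_L1 f : L1 (fun=> 1) -> L2 f -> L1 f.
Proof.
move=> I1 [mf If]; apply: (L1_le mf (L1D I1 If)) => x _.
have := sqr_ge0 (`|f x| - 1); rewrite -(real_normK (num_real (f x))).
by have := normr_ge0 (f x); nra.
Qed.

(** Integrate the nonnegative square of A / m - |f|, where A / m is the mean of |f| over [D]. *)
Lemma cauchy_schwarz_cst m f : 0 < m -> mu D = m%:E -> L1 f -> L1 (fun x => f x ^+ 2) ->
  (\int[mu]_(x in D) `|f x|) ^+ 2 <= m * \int[mu]_(x in D) (f x ^+ 2).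
Proof.
move=> m0 mDm If If2; set A := Rintegral _ _ _.
have I1 : L1 (fun=> 1).
  apply/integrableP; split; first exact/measurable_EFinP.
  rewrite (_ : integral _ _ _ = \int[mu]_(x in D) (cst 1%:E x))%E.
    by rewrite integral_cst // mul1e mDm ltry.
  by apply: eq_integral => x _ /=; rewrite normr1.
have In : L1 (fun x => `|f x|) by exact: integrable_norm.
have : \int[mu]_(x in D) (2 * (A / m) * `|f x|) <=
    \int[mu]_(x in D) ((A / m) ^+ 2 * 1 + f x ^+ 2).
  apply: le_Rintegral => //; [exact: L1Z|by apply: L1D => //; exact: L1Z|].
  move=> x _; rewrite -subr_ge0 mulr1 -(real_normK (num_real (f x))).
  by rewrite (_ : _ - _ = (A / m - `|f x|) ^+ 2) ?sqr_ge0 //; ring.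
rewrite RintegralZl // RintegralD //; [|by apply: L1Z].
rewrite RintegralZl // Rintegral_cst // mDm /= mul1r -/A => H.
have -> : A ^+ 2 = m * (2 * (A / m) * A - (A / m) ^+ 2 * m).
  by field; rewrite gt_eqF.
by rewrite ler_wpM2l ?(ltW m0) // lerBlDl.
Qed.

End square_integrable.

Lemma lebesgue_measure0T (R : realType) (T : R) : 0 < T ->
  lebesgue_measure `[0, T]%classic = T%:E.
Proof. by move=> T0; rewrite lebesgue_measure_itv /= lte_fin T0 -EFinB subr0. Qed.

(** * Integrals over time and sample space *)

Section process_integrals.
Context (R : realType) (d : measure_display) (Omega : measurableType d)
  (P : probability Omega R).
Local Notation leb := (@lebesgue_measure R).
Variables (T : R) (T_gt0 : 0 < T).
Local Notation cyl := (`[0, T] `*` [set: Omega]).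
Implicit Types (g X Y : R -> Omega -> R).

Definition uncurry2 g (z : R * Omega) := g z.1 z.2.

(** Integrability for the product measure. On this class [Eint], an iterated integral, equals the
    product integral ([Eint_prod]) and is therefore finite and linear. *)
Definition PL1 g := L1 (leb \x P)%E cyl (uncurry2 g).
Definition PL2 g := L2 (leb \x P)%E cyl (uncurry2 g).

Let mcyl : measurable (cyl : set (R * Omega)) := @measurable_cylinder _ _ Omega T.

Lemma PL1_jm g : PL1 g -> jm T g.
Proof. exact: L1_meas. Qed.

Lemma PL2_jm g : PL2 g -> jm T g.
Proof. by case. Qed.

(** Extension by zero, so that Fubini is applied on the whole product instead of the cylinder. *)
Let res g := (EFin \o uncurry2 g) \_ (cyl : set (R * Omega)).

Let res_section g w : (fun t => res g (t, w)) = (EFin \o g ^~ w) \_ `[0, T].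
Proof.
apply/funext => t; rewrite /res !patchE.
rewrite (_ : (t \in `[0, T]%classic) = ((t, w) \in cyl)) //.
by apply/idP/idP; rewrite !inE => //; case.
Qed.

Let resE g (h : \bar R -> \bar R) w : h 0%E = 0%E ->
  (\int[leb]_t h (res g (t, w)) = \int[leb]_(t in `[0%R, T]) h (g t w)%:E)%E.
Proof.
move=> h0; rewrite [RHS]integral_mkcond; apply: eq_integral => t _.
have /(congr1 (fun k => k t)) /= -> := res_section g w; rewrite !patchE.
by case: ifP.
Qed.

Let mres g : jm T g -> measurable_fun setT (res g).
Proof.
move=> mg; apply/(measurable_restrict _ mcyl measurableT).
by rewrite setTI; apply/measurable_EFinP.
Qed.

Let PL1E g : PL1 g <-> (leb \x P)%E.-integrable setT (res g).
Proof. by rewrite -integrable_mkcond. Qed.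

Lemma PL1P g : jm T g -> (Eint P T (fun t w => `|g t w|%R) < +oo)%E -> PL1 g.
Proof.
move=> mg Eg; apply/PL1E/integrable21ltyP; first exact: mres.
rewrite (eq_integral (fun w => \int[leb]_(t in `[0%R, T]) `|(g t w)%:E|)%E) // => w _.
by rewrite (resE _ (h := abse)) // abse0.
Qed.

Lemma PL1_ae g : PL1 g -> {ae P, forall w, L1 leb `[0, T] (g ^~ w)}.
Proof.
move=> /PL1E /ae_integrable2; apply: filterS => w.
by rewrite /L1 integrable_mkcond // -res_section.
Qed.

Lemma Eint_prod g : PL1 g ->
  Eint P T g = (\int[leb \x P]_(z in cyl) (g z.1 z.2)%:E)%E.
Proof.
move=> /[dup] Ig /PL1E Ires.
rewrite integral_mkcond -(integral21_prod_meas1 Ires); apply: eq_integral => w _.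
by rewrite /fubini_G (resE _ (h := id)).
Qed.

Lemma Eint_fin_num g : PL1 g -> Eint P T g \is a fin_num.
Proof. by move=> Ig; rewrite Eint_prod //; exact: integrable_fin_num. Qed.

Lemma PL1D f g : PL1 f -> PL1 g -> PL1 (fun t w => f t w + g t w).
Proof. exact: L1D. Qed.

Lemma PL1Z c g : PL1 g -> PL1 (fun t w => c * g t w).
Proof. exact: L1Z. Qed.

Lemma PL1_sum (I : Type) (r : seq I) (F : I -> R -> Omega -> R) :
  (forall i, PL1 (F i)) -> PL1 (fun t w => \sum_(i <- r) F i t w).
Proof.
move=> IF; exact: (@L1_sum _ _ _ (leb \x P)%E _ mcyl _ r (fun i => uncurry2 (F i))).
Qed.

Lemma PL2_mul f g : PL2 f -> PL2 g -> PL1 (fun t w => f t w * g t w).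
Proof. exact: L2_mul. Qed.

Lemma PL2D f g : PL2 f -> PL2 g -> PL2 (fun t w => f t w + g t w).
Proof. exact: L2D. Qed.

Lemma PL2Z c g : PL2 g -> PL2 (fun t w => c * g t w).
Proof. exact: L2Z. Qed.

Lemma PL2_sum (I : Type) (r : seq I) (F : I -> R -> Omega -> R) :
  (forall i, PL2 (F i)) -> PL2 (fun t w => \sum_(i <- r) F i t w).
Proof.
move=> IF; exact: (@L2_sum _ _ _ (leb \x P)%E _ mcyl _ r (fun i => uncurry2 (F i))).
Qed.

Lemma PL2_sqr g : PL2 g -> PL1 (fun t w => g t w ^+ 2).
Proof. by case. Qed.

Lemma PL2_cst0 : PL2 (fun _ _ => 0).
Proof. exact: L2_0. Qed.

Lemma EintD f g : PL1 f -> PL1 g ->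
  Eint P T (fun t w => f t w + g t w)%R = (Eint P T f + Eint P T g)%E.
Proof.
move=> If Ig; have Ifg : PL1 (fun t w => f t w + g t w) by exact: L1D.
by rewrite !Eint_prod // -integralD.
Qed.

Lemma EintZ c g : PL1 g -> Eint P T (fun t w => c * g t w)%R = (c%:E * Eint P T g)%E.
Proof.
move=> Ig; have Icg : PL1 (fun t w => c * g t w) by exact: L1Z.
by rewrite !Eint_prod // -integralZl.
Qed.

Lemma PL1_Eint_lty g : PL1 g -> (Eint P T g < +oo)%E.
Proof. by move=> /Eint_fin_num; rewrite fin_numElt => /andP[]. Qed.

Lemma PL1_norm g : PL1 g -> PL1 (fun t w => `|g t w|).
Proof. exact: integrable_norm. Qed.

Lemma jm_path g w : jm T g -> measurable_fun `[0, T] (g ^~ w).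
Proof.
move=> mg; apply: (@measurable_comp _ _ _ _ _ _ cyl (uncurry2 g) `[0, T] (pair^~ w)) => //.
- by move=> _ [t tT <-].
- exact: measurable_funTS (pair2_measurable w).
Qed.

Lemma measurable_inner_integral g : jm T g ->
  measurable_fun setT (fun w => \int[leb]_(t in `[0%R, T]) (g t w)%:E)%E.
Proof.
move=> mg; apply: (measurable_time_integral (h := fun z => (g z.1 z.2)%:E)).
exact/measurable_EFinP.
Qed.

Lemma eq_Eint f g : jm T f -> jm T g ->
  {ae P, forall w, forall t, 0 <= t <= T -> f t w = g t w} -> Eint P T f = Eint P T g.
Proof.
move=> mf mg fg; apply: ae_eq_integral => //; [exact: measurable_inner_integral..|].
apply: filterS fg => w fg _; apply: eq_integral => t.
by rewrite inE /= in_itv /= => /fg ->.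
Qed.

Lemma PL1_time_integral g : PL1 g ->
  L1 P setT (fun w => \int[leb]_(t in `[0, T]) g t w).
Proof.
move=> Ig; have mg := PL1_jm Ig; have In := PL1_norm Ig.
have mI := measurable_time_Rintegral (lexx T) mg.
apply/integrableP; split; first exact/measurable_EFinP.
apply: le_lt_trans (PL1_Eint_lty In); rewrite /Eint; apply: ge0_le_integral => //=.
- by apply/measurable_EFinP; apply: measurableT_comp mI.
- by apply: (@measurable_inner_integral (fun t w => `|g t w|)); exact: PL1_jm.
move=> w _; have mw := jm_path w mg.
apply: (@le_trans _ _ `|\int[leb]_(t in `[0%R, T]) (g t w)%:E|%E); last first.
  by apply: (le_abse_integral leb (f := EFin \o g ^~ w)) => //; exact/measurable_EFinP.
(* [fine] sends infinite values to 0, so the bound holds also on paths that are not integrable. *)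
by rewrite /Rintegral; case: (integral _ _ _) => [r| |] //=; rewrite leey.
Qed.

(** [Eint] integrates over time first, while moment bounds are available at each fixed time; Tonelli
    exchanges the two integrals. *)
Lemma Eint_lty_bound g (C : R) : jm T g -> (forall t w, 0 <= g t w) ->
  (forall t, 0 <= t <= T -> (\int[P]_w (g t w)%:E <= C%:E)%E) ->
  (Eint P T g < +oo)%E.
Proof.
move=> mg g0 gC; have res0 z : (0 <= res g z)%E.
  by rewrite /res patchE; case: ifP => // _; rewrite lee_fin; exact: g0.
have -> : Eint P T g = (\int[P]_w \int[leb]_t res g (t, w))%E.
  by apply: eq_integral => w _; rewrite (resE _ (h := id)).
rewrite -(fubini_tonelli (m1 := leb) (m2 := P) _ (mres mg) res0).
apply: (@le_lt_trans _ _ (\int[leb]_t ((cst C%:E \_ `[0%R, T]) t))%E); last first.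
  by rewrite -integral_mkcond integral_cst //= lebesgue_measure0T // -EFinM ltry.
apply: ge0_le_integral => //.
- by move=> t _; exact: integral_ge0.
- exact: (measurable_fun_fubini_tonelli_F (m2 := P) _ (mres mg) res0).
- by apply/(measurable_restrict _ _ measurableT) => //.
move=> t _; rewrite patchE; case: ifPn => tT.
  move: tT; rewrite inE /= in_itv /= => tT; apply: le_trans (gC _ tT).
  apply: ge0_le_integral => //.
  + exact: measurableT_comp (mres mg) (pair1_measurable t).
  + by apply/measurable_EFinP; exact: jm_section tT.
  + by move=> w _; rewrite /res patchE; case: ifP => _ //; rewrite lee_fin.
rewrite (eq_integral (cst 0%E)) ?integral0 // => w _.
rewrite /res patchE ifF //; apply: contraNF tT; rewrite !inE => -[].
by [].
Qed.

Lemma PL1_cst (Y : Omega -> R) : L1 P setT Y -> PL1 (fun _ w => Y w).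
Proof.
move=> IY; have mY := L1_meas IY.
apply: PL1P.
  by apply: (@measurable_comp _ _ _ _ _ _ setT Y) => //; exact: measurable_funTS measurable_snd.
rewrite /Eint (eq_integral (fun w => `|Y w|%:E * T%:E))%E; last first.
  by move=> w _; rewrite integral_cst //= lebesgue_measure0T.
apply: integrable_lty => //.
have := integrableZr measurableT T (integrable_abse IY).
exact.
Qed.

Lemma PL2_cst c : PL2 (fun _ _ => c).
Proof.
split; first exact: measurable_cst.
by apply: (PL1_cst (Y := fun=> c ^+ 2)); exact: finite_measure_integrable_cst.
Qed.

(** The domination may fail on a null set of paths, which is all that an equation holding almost
    surely can provide. *)
Lemma PL2_ae_le X g : jm T X -> PL1 g ->
  {ae P, forall w, forall t, 0 <= t <= T -> X t w ^+ 2 <= g t w} -> PL2 X.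
Proof.
move=> mX Ig Xg; split=> //.
have mX2 : jm T (fun t w => X t w ^+ 2) by exact: measurable_funX.
have In : PL1 (fun t w => `|g t w|) by exact: integrable_norm.
apply: (@PL1P (fun t w => X t w ^+ 2)) => //.
apply: le_lt_trans (PL1_Eint_lty In); rewrite /Eint.
apply: ae_ge0_le_integral => //.
- by move=> w _; apply: integral_ge0.
- by apply: measurable_inner_integral; exact: measurableT_comp.
- by move=> w _; apply: integral_ge0.
- by apply: measurable_inner_integral; exact: PL1_jm.
apply: filterS Xg => w Xg _; apply: ge0_le_integral => //.
- by apply/measurable_EFinP; apply: measurableT_comp => //; exact: (jm_path w mX2).
- by apply/measurable_EFinP; apply: measurableT_comp => //; exact: (jm_path w (PL1_jm Ig)).
move=> t /=; rewrite in_itv /= => tT.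
by rewrite lee_fin ger0_norm ?sqr_ge0 // (le_trans (Xg _ tT)) // ler_norm.
Qed.

Lemma PL2_ae b : PL2 b -> {ae P, forall w, L2 leb `[0, T] (b ^~ w)}.
Proof.
move=> /[dup] -[mb _] [_ /(PL1_ae (g := fun t w => b t w ^+ 2))].
by apply: filterS => w Ib; split=> //; exact: jm_path.
Qed.

End process_integrals.

Section path_integrals.
Context (R : realType).
Local Notation leb := (@lebesgue_measure R).
Variables (T : R) (T_gt0 : 0 < T).

Lemma path_L2_L1 (b : R -> R) : L2 leb `[0, T] b -> L1 leb `[0, T] b.
Proof.
apply: L2_L1 => //; apply/integrableP; split; first exact/measurable_EFinP.
rewrite (_ : integral _ _ _ = \int[leb]_(x in `[0%R, T]) (cst 1%:E x))%E.
  by rewrite integral_cst // mul1e /= lebesgue_measure0T // ltry.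
by apply: eq_integral => x _ /=; rewrite normr1.
Qed.

Lemma sqr_path_integral_le (b : R -> R) t : L2 leb `[0, T] b -> 0 <= t <= T ->
  (\int[leb]_(s in `[0, t]) b s) ^+ 2 <= T * \int[leb]_(s in `[0, T]) (b s ^+ 2).
Proof.
move=> /[dup] /path_L2_L1 Ib [mb Ib2] /andP[t0 tT].
apply: le_trans (cauchy_schwarz_cst _ T_gt0 (lebesgue_measure0T T_gt0) Ib Ib2) => //.
have st : `[0, t] `<=` `[0, T] by apply: subset_itvl; rewrite bnd_simp.
have Ibt : L1 leb `[0, t] b by apply: integrableS Ib.
have In : L1 leb `[0, T] (fun s => `|b s|) by exact: integrable_norm.
have Int : L1 leb `[0, t] (fun s => `|b s|) by exact: integrable_norm.
rewrite -[leLHS]real_normK ?num_real // ler_pXn2r ?nnegrE ?Rintegral_ge0 //.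
apply: (le_trans (le_normr_Rintegral _ _)) => //.
rewrite /Rintegral; apply: fine_le; [exact: integrable_fin_num..|].
apply: ge0_subset_integral => //.
- by have /integrableP[] := In.
Qed.

End path_integrals.

(** * Second moment of Brownian motion *)

Section normal_second_moment.
Context (R : realType).
Local Notation leb := (@lebesgue_measure R).

(** Change of variables is used with the Radon-Nikodym derivative, which agrees almost everywhere
    with the Gaussian density because both have the same integral over every measurable set. *)
Lemma ge0_integral_normal_prob (s : R) (f : R -> R) : measurable_fun setT f ->
  (forall x, 0 <= f x) ->
  (\int[normal_prob 0%R s]_x (f x)%:E = \int[leb]_x ((f x)%:E * (normal_pdf 0 s x)%:E))%E.
Proof.
move=> mf f0.
have dom := @normal_prob_dominates R 0 s.
have mpdf : measurable_fun setT (EFin \o normal_pdf (0 : R) s).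
  by apply/measurable_EFinP; exact: measurable_normal_pdf.
pose rn := Radon_Nikodym_SigmaFinite.f (normal_prob (0 : R) s) leb.
have mrn : measurable_fun setT rn.
  exact: measurable_int (Radon_Nikodym_SigmaFinite.f_integrable dom).
have mfE : measurable_fun setT (EFin \o f) by exact/measurable_EFinP.
have rnE : ae_eq leb setT (EFin \o normal_pdf (0 : R) s) rn.
  apply: integral_ae_eq => //; first exact: integrable_normal_pdf.
  move=> E _ mE.
  exact: (@Radon_Nikodym_SigmaFinite.f_integral _ _ R (normal_prob 0 s) leb dom E mE).
rewrite -(@Radon_Nikodym_SigmaFinite.change_of_variables _ _ R (normal_prob 0 s) leb dom
  (EFin \o f)) //.
apply: ae_eq_integral => //; [exact: emeasurable_funM..|].
by apply: filterS rnE => x /(_ I) rnx _ /=; congr (_ * _)%E; rewrite -/rn -rnx.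
Qed.

(* Doubling the deviation leaves a factor [exp (- 3 x^2 / (8 s^2))] to absorb
   [x^2], which avoids computing the variance. *)
Lemma sqr_normal_pdf_le (s x : R) : 0 < s ->
  x ^+ 2 * normal_pdf 0 s x <= 6 * s ^+ 2 * normal_pdf 0 (2 * s) x.
Proof.
move=> s0; have s20 : 2 * s != 0 by rewrite mulf_neq0 // gt_eqF.
rewrite !normal_pdfE ?gt_eqF ?mulr_gt0 //.
have -> : normal_peak (2 * s) = normal_peak s / 2.
  rewrite /normal_peak (_ : (2 * s) ^+ 2 * pi *+ 2 = 2 ^+ 2 * (s ^+ 2 * pi *+ 2)).
    by rewrite sqrtrM ?sqr_ge0 // sqrtr_sqr ger0_norm // invfM mulrC.
  ring.
have p0 := normal_peak_ge0 s.
(* The gap between the two Gaussian exponents: 1/2 - 1/8 = 3/8. *)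
pose y := x ^+ 2 / (s ^+ 2) * (3 / 8).
have y0 : 0 <= y by rewrite mulr_ge0 // divr_ge0 ?sqr_ge0.
have xy : x ^+ 2 = y * (8 / 3) * s ^+ 2.
  by rewrite /y; field; rewrite gt_eqF.
have e1 : normal_fun 0 s x = normal_fun 0 (2 * s) x * expR (- y).
  rewrite /normal_fun -expRD; congr expR; rewrite /y.
  by field; rewrite gt_eqF.
have ye : y * expR (- y) <= 1.
  rewrite expRN ler_pdivrMr ?expR_gt0 // mul1r.
  by have := expR_ge1Dx y; lra.
rewrite e1 {1}xy.
have := normal_fun_ge0 0 (2 * s) x; set g := normal_fun _ _ _ => g0.
set p := normal_peak s in p0 *; set e := expR (- y) in ye *.
(* Since y exp (- y) <= 1, the left side carries the constant 8/3; halving the peak leaves 6/2 = 3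
   on the right. *)
have -> : y * (8 / 3) * s ^+ 2 * (p * (g * e)) = (8 / 3) * s ^+ 2 * p * g * (y * e) by ring.
have -> : 6 * s ^+ 2 * (p / 2 * g) = 3 * s ^+ 2 * p * g * 1 by field.
have c0 : 0 <= s ^+ 2 * p * g.
  by apply: mulr_ge0 => //; apply: mulr_ge0 => //; exact: sqr_ge0.
have ye0 : 0 <= y * e by rewrite mulr_ge0 ?expR_ge0.
by nra.
Qed.

Lemma normal_second_moment (s : R) : 0 < s ->
  (\int[normal_prob 0%R s]_x (x ^+ 2)%:E <= (6 * s ^+ 2)%:E)%E.
Proof.
move=> s0; rewrite ge0_integral_normal_prob => [||x]; last 2 first.
- exact: measurable_funX.
- exact: sqr_ge0.
have mpdf c : measurable_fun setT (EFin \o normal_pdf (0 : R) c).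
  by apply/measurable_EFinP; exact: measurable_normal_pdf.
have -> : (6 * s ^+ 2)%:E = (\int[leb]_x ((6 * s ^+ 2)%:E * (normal_pdf 0%R (2 * s) x)%:E))%E.
  rewrite ge0_integralZl //.
  - by rewrite integral_normal_pdf mule1.
  - exact: mpdf.
  - by move=> x _; rewrite lee_fin normal_pdf_ge0.
  - by rewrite lee_fin mulr_ge0 ?sqr_ge0.
apply: ge0_le_integral => //.
- by move=> x _; rewrite mule_ge0 ?lee_fin ?sqr_ge0 ?normal_pdf_ge0.
- by apply: emeasurable_funM; [exact/measurable_EFinP/measurable_funX|exact: mpdf].
- by apply: emeasurable_funM; [exact: measurable_cst|exact: mpdf].
by move=> x _; rewrite -!EFinM lee_fin sqr_normal_pdf_le.
Qed.

End normal_second_moment.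

Section brownian_moment.
Context (R : realType) (d : measure_display) (Omega : measurableType d)
  (P : probability Omega R).

(** Almost surely B(t) is the increment over [0, t], whose law is normal with deviation sqrt t.
    Increments are described only for s < t, so t = 0 is separate. *)
Lemma brownian_second_moment (B : R -> Omega -> R) t : brownian1 P B -> 0 <= t ->
  (\int[P]_w (B t w ^+ 2)%:E <= (6 * t)%:E)%E.
Proof.
move=> [mB B0 _ gB _]; rewrite le_eqVlt => /predU1P[<-|t0].
  have m0 : measurable_fun setT (B 0) by exact: mB.
  rewrite (ae_eq_integral (cst 0%E)) //.
  - by rewrite integral0 mulr0.
  - exact/measurable_EFinP/measurable_funX.
  - by apply: filterS B0 => w /= -> _; rewrite expr0n.
have mt : measurable_fun setT (B t) by exact/mB/ltW.
have m0 : measurable_fun setT (B 0) by exact: mB.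
have mI : measurable_fun setT (incr B 0 t) by exact: measurable_funB.
rewrite (ae_eq_integral (fun w => (incr B 0 t w ^+ 2)%:E)) //; first last.
- by apply: filterS B0 => w /= Bw _; rewrite /incr Bw subr0.
- exact/measurable_EFinP/measurable_funX.
- exact/measurable_EFinP/measurable_funX.
have mI' : measurable_fun setT (incr B 0 t : Omega -> measurableTypeR R) by exact: mI.
have := @ge0_integral_pushforward _ _ _ _ R _ mI' P setT (fun x => (x ^+ 2)%:E).
rewrite preimage_setT => <- //; first last.
- by move=> x _; rewrite lee_fin sqr_ge0.
- exact/measurable_EFinP/measurable_funX.
apply: (@le_trans _ _ (\int[normal_prob 0%R (Num.sqrt t)]_x (x ^+ 2)%:E)%E); last first.
  have := @normal_second_moment R (Num.sqrt t).
  by rewrite sqrtr_gt0 sqr_sqrtr ?(ltW t0) //; exact.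
rewrite le_eqVlt; apply/orP; left; apply/eqP; apply: eq_measure_integral.
move=> C mC _; have := gB 0 t (lexx _) t0 C mC.
by rewrite subr0.
Qed.

End brownian_moment.

(** * Linear equations driven by a random process *)

Section linear_equations.
Context (R : realType) (d : measure_display) (Omega : measurableType d)
  (P : probability Omega R).
Local Notation leb := (@lebesgue_measure R).
Variables (T : R) (T_gt0 : 0 < T).
Local Notation pr m := (process R Omega m).

Let T_ge0 : 0 <= T. Proof. exact: ltW. Qed.

(** An almost sure property need not define a measurable set; the core does, so its indicator may
    multiply processes. *)
Lemma ae_measurable_core (Q : Omega -> Prop) : {ae P, forall w, Q w} ->
  exists G : set Omega, [/\ measurable G, {ae P, forall w, G w} & forall w, G w -> Q w].
Proof.
move=> [A [mA PA QA]]; exists (~` A); split.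
- exact: measurableC.
- by exists A; split=> // w /=; rewrite notK.
- by move=> w; apply: contra_notP => nQ; exact: QA.
Qed.

Lemma ae_forall (I : finType) (Q : I -> Omega -> Prop) :
  (forall i, {ae P, forall w, Q i w}) -> {ae P, forall w, forall i, Q i w}.
Proof.
move=> aeQ.
have /(filterS _) : {ae P, forall w, forall i, i \in enum I -> Q i w}.
  elim: (enum I) => [|i s IH]; first by apply: filterE.
  apply: filterS2 (aeQ i) IH => w Qi Qs j.
  by rewrite inE => /orP[/eqP ->|/Qs].
by apply => w Qw i; apply: Qw; rewrite mem_enum.
Qed.

(** Multiplying by the indicator of a measurable event on which paths are continuous makes every
    path continuous, as [caratheodory] requires, and alters the process only on one null set common
    to all times. *)
Lemma brownian1_version (B : R -> Omega -> R) : brownian1 P B ->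
  exists B' : R -> Omega -> R,
    [/\ forall w, {within `[0, T], continuous (B' ^~ w)}, PL2 P T B',
        L2 P setT (B' T) & {ae P, forall w, forall t, B t w = B' t w}].
Proof.
move=> bB; have [mB _ cB _ _] := bB.
have [G [mG aeG GQ]] := ae_measurable_core cB.
pose B' t w := B t w * \1_G w.
have BG w : G w -> B' ^~ w = B ^~ w.
  by move=> Gw; apply/funext => t; rewrite /B' indicE mem_set // mulr1.
have BnG w : ~ G w -> B' ^~ w = fun=> 0.
  by move=> Gw; apply/funext => t; rewrite /B' indicE memNset // mulr0.
have cB' w : {within `[0, T], continuous (B' ^~ w)}.
  have [Gw|Gw] := pselect (G w); last by rewrite BnG // => x; exact: cvg_cst.
  rewrite BG //; apply: continuous_subspaceW (GQ _ Gw).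
  by move=> s /=; rewrite !in_itv /= => /andP[->].
have mB' t : 0 <= t -> measurable_fun setT (B' t).
  by move=> t0; apply: measurable_funM; [exact: mB|exact: measurable_indic].
have B'B w : forall t, G w -> B t w = B' t w by move=> t Gw; have := BG w Gw => /(congr1 (fun k => k t)).
have jB' : jm T B' by apply: caratheodory => // t /andP[t0 _]; exact: mB'.
(* The cut-off can only decrease the square, so the moment bound for [B] survives, uniformly up to
   [T]. *)
have B2 t : 0 <= t <= T -> (\int[P]_w (B' t w ^+ 2)%:E <= (6 * T)%:E)%E.
  move=> /andP[t0 tT]; apply: (@le_trans _ _ (6 * t)%:E); last by rewrite lee_fin ler_wpM2l.
  apply: le_trans (brownian_second_moment bB t0); apply: ge0_le_integral => //.
  - by move=> w _; rewrite lee_fin sqr_ge0.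
  - by apply/measurable_EFinP/measurable_funX/mB'.
  - by apply/measurable_EFinP/measurable_funX/mB.
  move=> w _; rewrite lee_fin; have [Gw|Gw] := pselect (G w); first by rewrite (B'B w).
  by have := BnG w Gw => /(congr1 (fun k => k t)) ->; rewrite expr0n sqr_ge0.
exists B'; split=> //.
- split=> //; apply: (@PL1P _ _ _ P _ (fun t w => B' t w ^+ 2)); first exact: measurable_funX.
  apply: (@Eint_lty_bound _ _ _ P _ T_gt0 (fun t w => `|B' t w ^+ 2|) (6 * T)).
  + by apply: measurableT_comp => //; exact: measurable_funX.
  + by move=> t w; rewrite normr_ge0.
  + move=> t tT; rewrite (eq_integral (fun w => (B' t w ^+ 2)%:E)) => [|w _].
      exact: B2.
    by rewrite ger0_norm ?sqr_ge0.
- have mBT : measurable_fun setT (B' T) by exact: mB'.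
  split=> //; apply/integrableP; split; first exact/measurable_EFinP/measurable_funX.
  rewrite (eq_integral (fun w => (B' T w ^+ 2)%:E)) => [|w _].
    by apply: le_lt_trans (B2 T _) _; rewrite ?ltry // T_ge0 lexx.
  by rewrite /= ger0_norm ?sqr_ge0.
- by apply: filterS aeG => w Gw t; exact: B'B.
Qed.

Definition cpath m (X : pr m) (l : 'I_m) t w := X t w l 0.

Lemma brownian_version k (W : pr k) : brownian P W -> exists W' : pr k,
  [/\ forall l w, {within `[0, T], continuous (fun t => W' t w l 0)},
      forall l, PL2 P T (cpath W' l), forall l, L2 P setT (cpath W' l T) &
      {ae P, forall w, forall t, W t w = W' t w}].
Proof.
move=> [bW _].
have [B' B'P] := fin_all_exists (fun l => brownian1_version (bW l)).
pose W' : pr k := fun t w => \col_l B' l t w.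
have W'E l : cpath W' l = B' l by apply/funext => t; apply/funext => w; rewrite /cpath mxE.
exists W'; split.
- move=> l w; rewrite (_ : (fun t => _) = B' l ^~ w); first by case: (B'P l).
  by apply/funext => t; rewrite mxE.
- by move=> l; rewrite W'E; case: (B'P l).
- by move=> l; rewrite W'E; case: (B'P l).
- have /ae_forall : forall l, {ae P, forall w, forall t, W t w l 0 = B' l t w}.
    by move=> l; case: (B'P l).
  by apply: filterS => w BW t; apply/colP => l; rewrite mxE BW.
Qed.

Definition pathL1 m (g : pr m) := {ae P, forall w, forall l, L1 leb `[0, T] (fun t => g t w l 0)}.

Definition contw m (X : pr m) w :=
  forall l, {within `[0, T], continuous (fun t => X t w l 0)}.

(** The bridge from [solves] to the Volterra equations: continuity of [X] and path integrability of
    [g] make both parts of the drift integrable, so the integral splits. *)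
Lemma vint_linear m (K : 'M[R]_m) (X g : pr m) w t : contw X w ->
  (forall l, L1 leb `[0, T] (fun t => g t w l 0)) -> 0 <= t <= T ->
  forall l, vint t (fun s => K *m X s w + g s w) l 0 =
    kint K (fun j s => X s w j 0) l t + \int[leb]_(s in `[0, t]) g s w l 0.
Proof.
move=> cX Ig /andP[t0 tT] l; rewrite mxE /kint -RintegralD //.
- by apply: eq_Rintegral => s _; rewrite !mxE.
- apply: continuous_integrable tT.
  apply: within_continuous_sum => j; apply: within_continuousM => //.
  by move=> x; exact: cvg_cst.
- apply: integrableS (Ig l) => //.
  by apply: subset_itvl; rewrite bnd_simp.
Qed.

(** Initial value, input and noise cancel in the difference, which solves the homogeneous Volterra
    equation on almost every path. *)
Lemma solves_unique m (K : 'M[R]_m) (g M : pr m) xi (X Y : pr m) : pathL1 g ->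
  solves P T xi (fun t w => K *m X t w + g t w) M X ->
  solves P T xi (fun t w => K *m Y t w + g t w) M Y ->
  {ae P, forall w, forall t, 0 <= t <= T -> X t w = Y t w}.
Proof.
move=> Ig [_ sX] [_ sY]; apply: filterS3 Ig sX sY => w Ig [cX eX] [cY eY].
pose D (l : 'I_m) s := X s w l 0 - Y s w l 0.
have cD l : {within `[0, T], continuous (D l)} by exact: within_continuousB.
have DE l t : 0 <= t <= T -> D l t = kint K D l t.
  move=> tT; rewrite /D (eX _ tT) (eY _ tT) !mxE.
  have := vint_linear K cX Ig tT l; rewrite mxE => ->.
  have := vint_linear K cY Ig tT l; rewrite mxE => ->.
  set a := Rintegral _ _ _.
  rewrite [LHS](_ : _ = kint K (fun j s => X s w j 0) l t - kint K (fun j s => Y s w j 0) l t).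
    have /andP[_ tT'] := tT.
    rewrite /kint -RintegralB //.
    + by apply: eq_Rintegral => s _; rewrite -sumrB; apply: eq_bigr => j _; rewrite mulrBr.
    + apply: continuous_integrable tT'.
      by apply: within_continuous_sum => j; apply: within_continuousM => // x; exact: cvg_cst.
    + apply: continuous_integrable tT'.
      by apply: within_continuous_sum => j; apply: within_continuousM => // x; exact: cvg_cst.
  ring.
move=> t tT; apply/colP => l; apply/eqP; rewrite -subr_eq0; apply/eqP.
exact: (volterra_unique T_ge0 cD DE).
Qed.

Lemma PL2_pathL1 m (g : pr m) : (forall l, PL2 P T (cpath g l)) -> pathL1 g.
Proof.
move=> g2; apply: ae_forall => l; have := PL2_ae (g2 l).
by apply: filterS => w; exact: path_L2_L1.
Qed.

Lemma solves_exists m (K : 'M[R]_m) (g M : pr m) (xi : Omega -> 'cV[R]_m) :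
  (forall l, measurable_fun setT (fun w => xi w l 0)) ->
  (forall l, jm T (cpath g l)) -> pathL1 g ->
  (forall l, jm T (cpath M l)) -> (forall w, contw M w) ->
  exists X : pr m, solves P T xi (fun t w => K *m X t w + g t w) M X.
Proof.
move=> mxi mg /ae_measurable_core[G [mG aeG GQ]] mM cM.
(* The indicator makes the forcing continuous on every path, also where [g] is not integrable, so
   that the Volterra solution is jointly measurable. On [G] nothing changes. *)
pose h (l : 'I_m) t w := (xi w l 0 + \int[leb]_(s in `[0, t]) g s w l 0 + M t w l 0) * \1_G w.
have ch l w : {within `[0, T], continuous (h l ^~ w)}.
  have [Gw|Gw] := pselect (G w); last first.
    rewrite (_ : h l ^~ w = fun=> 0); first by move=> x; exact: cvg_cst.
    by apply/funext => t; rewrite /h indicE memNset // mulr0.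
  rewrite (_ : h l ^~ w = fun t => xi w l 0 + \int[leb]_(s in `[0, t]) g s w l 0 + M t w l 0).
    apply: within_continuousD; last exact: cM.
    apply: within_continuousD; first by move=> x; exact: cvg_cst.
    apply: (@parameterized_integral_continuous R 0 T (fun s => g s w l 0)) => //.
    exact: GQ.
  by apply/funext => t; rewrite /h indicE mem_set // mulr1.
have mh l : jm T (h l).
  apply: caratheodory => // t /andP[t0 tT].
  apply: measurable_funM; last exact: measurable_indic.
  apply: measurable_funD; last by apply: (@jm_section _ _ _ _ (cpath M l)) => //; rewrite t0.
  by apply: measurable_funD => //; apply: (measurable_time_Rintegral tT) (mg l).
pose X : pr m := fun t w => \col_l volterra K (fun j s => h j s w) l t.
have XE w l : (fun t => X t w l 0) = volterra K (fun j s => h j s w) l.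
  by apply/funext => t; rewrite mxE.
exists X; split.
  move=> l; have := jm_volterra K T_ge0 mh ch l.
  by apply: eq_measurable_fun => z _; rewrite mxE.
apply: filterS aeG => w Gw.
have cX l : {within `[0, T], continuous (fun t => X t w l 0)}.
  by rewrite XE; exact: volterra_continuous.
split=> // t tT; apply/colP => l.
have := vint_linear K cX (GQ _ Gw) tT l; rewrite !mxE => ->.
rewrite (volterraE _ T_ge0 (ch ^~ w) _ tT).
rewrite (_ : (fun j s => X s w j 0) = volterra K (fun j s => h j s w)).
  by rewrite /h indicE mem_set // mulr1; ring.
by apply/funext => j; rewrite XE.
Qed.

(** The crude constant 2^size comes from iterating (a + b)^2 <= 2 a^2 + 2 b^2. *)
Lemma sqr_sum_le (I : Type) (r : seq I) (a : I -> R) :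
  (\sum_(i <- r) a i) ^+ 2 <= 2 ^+ size r * \sum_(i <- r) a i ^+ 2.
Proof.
elim: r => [|i r IH]; first by rewrite !big_nil expr0n mulr0.
rewrite !big_cons /= [2 ^+ _.+1]exprS.
have : 0 <= (2 ^+ size r - 1) * a i ^+ 2.
  by rewrite mulr_ge0 ?sqr_ge0 // subr_ge0 exprn_ege1 // ler1n.
have := sqr_ge0 (a i - \sum_(j <- r) a j).
move: IH; move: (\sum_(j <- r) a j) (\sum_(j <- r) a j ^+ 2) (2 ^+ size r) (a i).
by move=> S S2 e b; nra.
Qed.

(** Square [volterra_bound] path by path and integrate: the forcing is square integrable and the
    constant does not depend on the path. *)
Lemma solves_L2 m (K : 'M[R]_m) (g M : pr m) (xi : Omega -> 'cV[R]_m) (X : pr m) :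
  (forall l, L2 P setT (fun w => xi w l 0)) ->
  (forall l, PL2 P T (cpath g l)) ->
  (forall l, PL2 P T (cpath M l)) -> (forall l, L2 P setT (cpath M l T)) ->
  (forall w, contw M w) ->
  solves P T xi (fun t w => K *m X t w + g t w) M X ->
  forall l, PL2 P T (cpath X l) /\ L2 P setT (cpath X l T).
Proof.
move=> xi2 g2 M2 MT2 cM [jX sX].
have [C C0 CP] := volterra_bound K T_ge0.
pose G2 l w := \int[leb]_(s in `[0, T]) (g s w l 0 ^+ 2).
have IG2 l : L1 P setT (G2 l).
  exact: (PL1_time_integral (PL2_sqr (g2 l))).
(* Majorant of the squared forcing: a three-term square costs a factor 3, and Cauchy-Schwarz bounds
   the squared integral of [g] by [T * G2]. *)
pose q l t w := 3 * (xi w l 0 ^+ 2 + T * G2 l w) + 3 * M t w l 0 ^+ 2.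
have Ic l : L1 P setT (fun w => 3 * (xi w l 0 ^+ 2 + T * G2 l w)).
  by apply: L1Z => //; apply: L1D => //; [case: (xi2 l)|exact: L1Z].
have Iq l : PL1 P T (q l).
  have Ic' := PL1_cst T_gt0 (Ic l).
  have IM : PL1 P T (fun t w => 3 * M t w l 0 ^+ 2).
    exact: (PL1Z 3 (PL2_sqr (M2 l))).
  exact: (PL1D Ic' IM).
have IqT l : L1 P setT (q l T).
  by apply: L1D => //; apply: L1Z => //; case: (MT2 l).
pose Q w := \sum_(l < m) \int[leb]_(s in `[0, T]) q l s w.
have IQ : L1 P setT Q by apply: L1_sum => // l; exact: PL1_time_integral.
(* From 2 C^2 S^2, where S is the integral of the summed norms of the forcing: S^2 <= T 2^size Q by
   Cauchy-Schwarz and [sqr_sum_le]. *)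
pose c := 2 * (C ^+ 2 * (T * 2 ^+ size (index_enum 'I_m))).
have bound : {ae P, forall w, forall l t, 0 <= t <= T ->
    X t w l 0 ^+ 2 <= 2 * q l t w + c * Q w}.
  have aeq : {ae P, forall w, forall l, L1 leb `[0, T] (q l ^~ w)}.
    by apply: ae_forall => l; exact: PL1_ae.
  have aeg : {ae P, forall w, forall l, L2 leb `[0, T] (cpath g l ^~ w)}.
    by apply: ae_forall => l; exact: PL2_ae.
  apply: filterS3 sX aeg aeq => w [cX eX] g2w qw.
  have g1w l : L1 leb `[0, T] (fun t => g t w l 0) by exact: (path_L2_L1 T_gt0 (g2w l)).
  pose h (l : 'I_m) t := xi w l 0 + \int[leb]_(s in `[0, t]) g s w l 0 + M t w l 0.
  have ch l : {within `[0, T], continuous (h l)}.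
    apply: within_continuousD; last exact: cM.
    apply: within_continuousD; first by move=> x; exact: cvg_cst.
    apply: (@parameterized_integral_continuous R 0 T (fun s => g s w l 0)) => //.
    exact: g1w.
  have XE l t : 0 <= t <= T -> X t w l 0 = h l t + kint K (fun j s => X s w j 0) l t.
    move=> tT; rewrite {1}(eX _ tT) !mxE.
    by have := vint_linear K cX g1w tT l; rewrite mxE => ->; rewrite /h; ring.
  have hq l t : 0 <= t <= T -> h l t ^+ 2 <= q l t w.
    move=> tT; have := sqr_path_integral_le T_gt0 (g2w l) tT.
    rewrite -/(G2 l w) /h /q; set I := Rintegral _ _ _; set a := xi w l 0; set b := M t w l 0.
    have := sqr_ge0 (a - I); have := sqr_ge0 (a - b); have := sqr_ge0 (I - b).
    by nra.
  move=> l t tT; have /(_ l t tT) XB := CP h (fun j s => X s w j 0) ch cX XE.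
  set S := \int[leb]_(s in `[0, T]) \sum_j `|h j s| in XB.
  have cnorm : {within `[0, T], continuous (fun s => \sum_j `|h j s|)}.
    by apply: within_continuous_sum => j x; apply: cvg_norm; exact: ch.
  have SQ : S ^+ 2 <= T * (2 ^+ size (index_enum 'I_m) * Q w).
    have I1 := continuous_integrable cnorm (lexx T).
    have I2 : L1 leb `[0, T] (fun s => (\sum_j `|h j s|) ^+ 2).
      apply: continuous_integrable (lexx T).
      exact: (within_continuousM cnorm cnorm).
    have S_norm : \int[leb]_(s in `[0, T]) `|\sum_j `|h j s| | = S.
      by apply: eq_Rintegral => s _; rewrite ger0_norm // sumr_ge0.
    have := @cauchy_schwarz_cst _ _ _ leb `[0, T] _ T _ T_gt0 (lebesgue_measure0T T_gt0) I1 I2.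
    rewrite S_norm => /(_ _)/le_trans; apply => //; rewrite ler_wpM2l //.
    have Iqw : L1 leb `[0, T] (fun s => \sum_l q l s w) by exact: L1_sum.
    have -> : Q w = \int[leb]_(s in `[0, T]) \sum_l q l s w.
      rewrite /Q; elim: (index_enum _) => [|i r IH].
        transitivity (\int[leb]_(s in `[0, T]) (0 : R)); last first.
          by apply: eq_Rintegral => s _; rewrite big_nil.
        by rewrite big_nil Rintegral_cst // mul0r.
      rewrite big_cons IH -RintegralD //; [|exact: qw|exact: L1_sum].
      by apply: eq_Rintegral => s _; rewrite big_cons.
    rewrite -RintegralZl //; apply: le_Rintegral => //; first exact: L1Z.
    move=> s /=; rewrite in_itv /= => sT; apply: (le_trans (sqr_sum_le _ _)).
    rewrite ler_wpM2l ?exprn_ge0 //; apply: ler_sum => j _.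
    by rewrite real_normK ?num_real //; exact: hq.
  have S0 : 0 <= S by apply: Rintegral_ge0 => s _; exact: sumr_ge0.
  have := hq l t tT; rewrite -[h l t ^+ 2]real_normK ?num_real //.
  rewrite -[X t w l 0 ^+ 2]real_normK ?num_real // /c => hql.
  apply: (@le_trans _ _ (2 * `|h l t| ^+ 2 + 2 * (C ^+ 2 * S ^+ 2))).
    apply: (@le_trans _ _ ((`|h l t| + C * S) ^+ 2)).
      by rewrite ler_pXn2r // nnegrE addr_ge0 // mulr_ge0.
    rewrite -exprMn -subr_ge0 (_ : _ - _ = (`|h l t| - C * S) ^+ 2) ?sqr_ge0 //.
    ring.
  apply: lerD; first by rewrite ler_wpM2l.
  by rewrite -!mulrA !ler_wpM2l.
move=> l; split.
- apply: (PL2_ae_le (g := fun t w => 2 * q l t w + c * Q w)).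
  + exact: jX.
  + exact: (PL1D (PL1Z 2 (Iq l)) (PL1Z c (PL1_cst T_gt0 IQ))).
  + by apply: filterS bound => w bw t tT; exact: bw.
- have mXT : measurable_fun setT (cpath X l T).
    by apply: (@jm_section _ _ _ T (cpath X l)); [exact: jX|rewrite T_ge0 lexx].
  split=> //.
  have IB : L1 P setT (fun w => 2 * q l T w + c * Q w) by apply: L1D => //; exact: L1Z.
  have In : L1 P setT (fun w => `|2 * q l T w + c * Q w|) by exact: integrable_norm.
  apply/integrableP; split; first exact/measurable_EFinP/measurable_funX.
  apply: le_lt_trans (integrable_lty measurableT In); apply: ae_ge0_le_integral => //.
  + by do 2!apply: measurableT_comp => //; exact: measurable_funX.
  + by move=> w _; rewrite lee_fin.
  + by apply/measurable_EFinP; exact: L1_meas In.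
  apply: filterS bound => w bw _.
  rewrite /= lee_fin ger0_norm ?sqr_ge0 //; apply: le_trans (ler_norm _).
  by apply: bw; rewrite T_ge0 lexx.
Qed.

End linear_equations.

(** * Superposition and block structure *)

Section solutions.
Context (R : realType) (d : measure_display) (Omega : measurableType d)
  (P : probability Omega R).
Local Notation leb := (@lebesgue_measure R).
Variables (T : R) (T_gt0 : 0 < T).
Local Notation pr m := (process R Omega m).

Lemma within_itv_eq (f g : R -> R) : (forall t, 0 <= t <= T -> f t = g t) ->
  {within `[0, T], continuous f} -> {within `[0, T], continuous g}.
Proof.
move=> fg cf; apply: subspace_eq_continuous cf => t.
by rewrite inE /= in_itv /= => /fg.
Qed.

(** Joint measurability of [X'] is assumed separately because almost sure equality does not transfer
    it. *)
Lemma solves_ae m xi (b b' M M' X X' : pr m) : jmeasurable T X' ->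
  {ae P, forall w, forall t, 0 <= t <= T ->
    [/\ X t w = X' t w, b t w = b' t w & M t w = M' t w]} ->
  solves P T xi b M X -> solves P T xi b' M' X'.
Proof.
move=> jX' ae [_ sX]; split=> //; apply: filterS2 ae sX => w H [cX eX].
split=> [l|t tT].
  by apply: within_itv_eq (cX l) => t /H[-> _ _].
have [<- _ <-] := H t tT; rewrite (eX _ tT); congr (_ + _ + _).
apply/colP => l; rewrite !mxE; apply: eq_Rintegral => s.
rewrite inE /= in_itv /= => /andP[s0 st]; have /andP[_ tT'] := tT.
have /H[_ -> _ //] : 0 <= s <= T.
by rewrite s0 (le_trans st).
Qed.

Lemma jm_comb m (X Y : pr m) a c : jmeasurable T X -> jmeasurable T Y ->
  jmeasurable T (fun t w => a *: X t w + c *: Y t w).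
Proof.
move=> jX jY l.
apply: (eq_measurable_fun (fun z : R * Omega => a * X z.1 z.2 l 0 + c * Y z.1 z.2 l 0)).
  by move=> z _; rewrite !mxE.
by apply: measurable_funD; apply: measurable_funM.
Qed.

Lemma solves_comb m (K : 'M[R]_m) (g g' M M' X Y : pr m) xi xi' a c :
  pathL1 P T g -> pathL1 P T g' ->
  solves P T xi (fun t w => K *m X t w + g t w) M X ->
  solves P T xi' (fun t w => K *m Y t w + g' t w) M' Y ->
  solves P T (fun w => a *: xi w + c *: xi' w)
    (fun t w => K *m (a *: X t w + c *: Y t w) + (a *: g t w + c *: g' t w))
    (fun t w => a *: M t w + c *: M' t w) (fun t w => a *: X t w + c *: Y t w).
Proof.
move=> Ig Ig' [jX sX] [jY sY]; split; first exact: jm_comb.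
apply: filterS3 (filterI Ig Ig') sX sY => w [gw g'w] [cX eX] [cY eY].
split=> [l|t tT].
  rewrite (_ : (fun t => _) = fun t => a * X t w l 0 + c * Y t w l 0).
    by apply: within_continuousD; apply: within_continuousM => // x; exact: cvg_cst.
  by apply/funext => t; rewrite !mxE.
apply/colP => l; rewrite {1}(eX _ tT) {1}(eY _ tT) !mxE.
have /andP[t0 tT'] := tT.
have IK (Z h : pr m) : contw T Z w -> (forall l, L1 leb `[0, T] (fun t => h t w l 0)) ->
    L1 leb `[0, t] (fun s => (K *m Z s w + h s w) l 0).
  move=> cZ hw; have st : `[0, t] `<=` `[0, T] by apply: subset_itvl; rewrite bnd_simp.
  rewrite (_ : (fun s => _) = fun s => \sum_j K l j * Z s w j 0 + h s w l 0); last first.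
    by apply/funext => s; rewrite !mxE.
  apply: L1D => //; last exact: integrableS (hw l).
  apply: continuous_integrable tT'.
  by apply: within_continuous_sum => j; apply: within_continuousM => // x; exact: cvg_cst.
have I1 := IK _ _ cX gw; have I2 := IK _ _ cY g'w.
have -> : \int[leb]_(s in `[0, t])
    (K *m (a *: X s w + c *: Y s w) + (a *: g s w + c *: g' s w)) l 0 =
    a * \int[leb]_(s in `[0, t]) (K *m X s w + g s w) l 0 +
    c * \int[leb]_(s in `[0, t]) (K *m Y s w + g' s w) l 0.
  rewrite -!RintegralZl // -RintegralD //; [|exact: L1Z..].
  apply: eq_Rintegral => s _; rewrite mulmxDr -!scalemxAr !mxE.
  by ring.
by ring.
Qed.

End solutions.

(** * Block vectors and the Kronecker product *)

Section blocks.
Context (R : realType).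
Variables (N n : nat).
Implicit Types (x y : 'I_N -> 'cV[R]_n) (z : 'cV[R]_n) (M : 'M[R]_n).

Definition stack x : 'cV[R]_(N * n) :=
  \col_a x (mxtens_unindex a).1 (mxtens_unindex a).2 0.

Definition block (i : 'I_N) (v : 'cV[R]_(N * n)) : 'cV[R]_n :=
  \col_l v (mxtens_index (i, l)) 0.

Lemma stackE x i l : stack x (mxtens_index (i, l)) 0 = x i l 0.
Proof. by rewrite mxE mxtens_indexK. Qed.

Lemma stackK x i : block i (stack x) = x i.
Proof. by apply/colP => l; rewrite mxE stackE. Qed.

Lemma blockK v : stack (block^~ v) = v.
Proof.
by apply/colP => a; rewrite !mxE -surjective_pairing mxtens_unindexK.
Qed.

Lemma sum_mxtens (F : 'I_(N * n) -> R) :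
  \sum_a F a = \sum_i \sum_l F (mxtens_index (i, l)).
Proof.
rewrite pair_bigA /= (reindex (@mxtens_index N n)) /=.
  by apply: eq_bigr => -[].
by exists (@mxtens_unindex N n) => a _; rewrite ?mxtens_indexK ?mxtens_unindexK.
Qed.

Lemma stackD x y : stack x + stack y = stack (fun i => x i + y i).
Proof. by apply/colP => a; rewrite !mxE. Qed.

Lemma stackZ c x : c *: stack x = stack (fun i => c *: x i).
Proof. by apply/colP => a; rewrite !mxE. Qed.

Lemma stack0 : stack (fun=> 0) = 0.
Proof. by apply/colP => a; rewrite !mxE. Qed.

Lemma ones_tensE z : ones_tens N z = stack (fun=> z).
Proof. by apply/colP => a; rewrite !mxE mul1r; congr (z _ _); exact: ord1. Qed.

Lemma blkdiag_stack M x : blkdiag N M *m stack x = stack (fun i => M *m x i).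
Proof.
apply/colP => a; case: (mxtens_indexP a) => i l {a}; rewrite stackE !mxE sum_mxtens.
rewrite (bigD1 i) //= [X in _ + X]big1 ?addr0 => [|j ji]; last first.
  by apply: big1 => k _; rewrite !mxE !mxtens_indexK /= eq_sym (negbTE ji) mul0r.
by apply: eq_bigr => k _; rewrite stackE !mxE !mxtens_indexK /= eqxx.
Qed.

Lemma ones_mul i j : (ones R N *m (ones R N)^T) i j = 1.
Proof. by rewrite mxE big_ord1 !mxE mulr1. Qed.

Lemma ones_tens_stack M x :
  ((ones R N *m (ones R N)^T) *t M) *m stack x = stack (fun=> M *m \sum_j x j).
Proof.
apply/colP => a; case: (mxtens_indexP a) => i l {a}; rewrite stackE mulmx_sumr.
rewrite summxE mxE sum_mxtens; apply: eq_bigr => j _; rewrite mxE.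
by apply: eq_bigr => k _; rewrite stackE tensmxE ones_mul mul1r.
Qed.

Lemma Acheck_stack A G x :
  Acheck N A G *m stack x = stack (fun i => A *m x i + G *m avg x).
Proof.
rewrite mulmxDl -scalemxAl blkdiag_stack ones_tens_stack stackZ stackD.
by congr stack; apply/funext => i; rewrite /avg -scalemxAr.
Qed.

Lemma stack_mul x y : ((stack x)^T *m stack y) 0 0 = \sum_i ((x i)^T *m y i) 0 0.
Proof.
rewrite mxE sum_mxtens; apply: eq_bigr => i _; rewrite mxE; apply: eq_bigr => l _.
by rewrite [in LHS]mxE [in RHS]mxE !stackE.
Qed.

Lemma qform_blkdiag_const M z :
  qform (blkdiag N M) (stack (fun=> z)) = N%:R * qform M z.
Proof.
rewrite /qform -mulmxA blkdiag_stack stack_mul sumr_const card_ord -mulmxA.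
by rewrite mulr_natl.
Qed.

(** On a vector with equal blocks the averaging matrix acts as the identity, so [Qhat] acts
    blockwise as Q - Psi, which factors as (I - Gam)^T Q (I - Gam). *)
Lemma qform_Qhat_const Q Gam z : (0 < N)%N ->
  qform (Qhat N Q Gam) (stack (fun=> z)) = N%:R * qform Q ((1%:M - Gam) *m z).
Proof.
move=> N0; have N0' : N%:R != 0 :> R by rewrite pnatr_eq0 -lt0n.
rewrite /qform -mulmxA /Qhat mulmxBl blkdiag_stack -scalemxAl ones_tens_stack stackZ.
rewrite -scaleN1r stackZ stackD stack_mul sumr_const card_ord mulr_natl.
congr (_ *+ _); congr (fun_of_matrix _ 0 0).
rewrite sumr_const card_ord -[z *+ N]scaler_nat -scalemxAr [_^-1 *: _]scalerA mulVf // scale1r scaleN1r.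
rewrite -mulmxBl trmx_mul -!mulmxA; congr (_ *m _); rewrite !mulmxA; congr (_ *m z).
have -> : (1%:M - Gam)^T = 1%:M - Gam^T by rewrite raddfB /= trmx1.
rewrite /Psi !mulmxBl mul1mx !mulmxBr !mulmx1.
move: (Gam^T *m Q) (Q *m Gam) (Gam^T *m Q *m Gam) => a b c.
by rewrite !opprB opprD [c + _]addrA [c - a - b]addrC addrA.
Qed.

End blocks.

(** * Quadratic functionals and admissible inputs *)

Section quadratic_functionals.
Context (R : realType) (d : measure_display) (Omega : measurableType d)
  (P : probability Omega R).
Local Notation leb := (@lebesgue_measure R).
Variables (T : R) (T_gt0 : 0 < T).
Local Notation pr m := (process R Omega m).

Lemma qformE m (M : 'M[R]_m) z : qform M z = \sum_i z i 0 * \sum_j M i j * z j 0.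
Proof.
rewrite /qform -mulmxA mxE; apply: eq_bigr => i _; rewrite !mxE.
by congr (_ * _); apply: eq_bigr => j _.
Qed.

Lemma qform1E m (z : 'cV[R]_m) : qform 1%:M z = \sum_i z i 0 ^+ 2.
Proof. by rewrite /qform mulmx1 mxE; apply: eq_bigr => i _; rewrite mxE. Qed.

(** An exact identity, not an inequality: it gives the convexity gap of every cost below. It follows
    by expanding both sides and using lam^2 = lam - lam (1 - lam). *)
Lemma qform_comb m (M : 'M[R]_m) lam a b :
  qform M (lam *: a + (1 - lam) *: b) = lam * qform M a + (1 - lam) * qform M b
    - lam * (1 - lam) * qform M (a - b).
Proof.
have bil (u v u' v' : 'cV[R]_m) (s t : R) : qform M (s *: u + t *: v) =
    s ^+ 2 * qform M u + t ^+ 2 * qform M v +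
    s * t * ((u^T *m M *m v) 0 0 + (v^T *m M *m u) 0 0).
  have tr : (s *: u + t *: v)^T = s *: u^T + t *: v^T.
    by apply/matrixP => i j; rewrite !mxE.
  rewrite /qform tr !mulmxDl !mulmxDr -!scalemxAl -!scalemxAr.
  move: (u^T *m M *m u) (u^T *m M *m v) (v^T *m M *m u) (v^T *m M *m v) => p q p' q'.
  by rewrite !mxE; ring.
have -> : a - b = 1 *: a + (-1) *: b by rewrite scale1r scaleN1r.
rewrite !bil //; ring.
Qed.

(** The second clause is independent of the first: the terminal cost looks at the single time [T],
    which is null for the time integral. *)
Definition sqint m (X : pr m) :=
  (forall l, PL2 P T (cpath X l)) /\ (forall l, L2 P setT (cpath X l T)).

Lemma qform_PL1 m (M : 'M[R]_m) (X : pr m) : (forall l, PL2 P T (cpath X l)) ->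
  PL1 P T (fun t w => qform M (X t w)).
Proof.
move=> X2; rewrite (_ : (fun t w => _) = fun t w =>
    \sum_i cpath X i t w * \sum_j M i j * cpath X j t w); last first.
  by apply/funext => t; apply/funext => w; rewrite qformE.
by apply: PL1_sum => i; apply: PL2_mul => //; apply: PL2_sum => j; exact: PL2Z.
Qed.

Lemma qform_L1 m (M : 'M[R]_m) (Y : Omega -> 'cV[R]_m) :
  (forall l, L2 P setT (fun w => Y w l 0)) -> L1 P setT (fun w => qform M (Y w)).
Proof.
move=> Y2; rewrite (_ : (fun w => _) = fun w =>
    \sum_i Y w i 0 * \sum_j M i j * Y w j 0); last first.
  by apply/funext => w; rewrite qformE.
by apply: L1_sum => // i; apply: L2_mul => //; apply: L2_sum => // j; exact: L2Z.
Qed.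

Lemma cpath_lin m p (K : 'M[R]_(p, m)) (X : pr m) l :
  (forall l, PL2 P T (cpath X l)) -> PL2 P T (cpath (fun t w => K *m X t w) l).
Proof.
move=> X2; rewrite (_ : cpath _ _ = fun t w => \sum_j K l j * cpath X j t w).
  by apply: PL2_sum => j; exact: PL2Z.
by apply/funext => t; apply/funext => w; rewrite /cpath mxE.
Qed.

Lemma L2_lin m p (K : 'M[R]_(p, m)) (Y : Omega -> 'cV[R]_m) l :
  (forall l, L2 P setT (fun w => Y w l 0)) -> L2 P setT (fun w => (K *m Y w) l 0).
Proof.
move=> Y2; rewrite (_ : (fun w => _) = fun w => \sum_j K l j * Y w j 0).
  by apply: L2_sum => // j; exact: L2Z.
by apply/funext => w; rewrite mxE.
Qed.

Lemma cpathD m (X Y : pr m) a c l :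
  PL2 P T (cpath X l) -> PL2 P T (cpath Y l) ->
  PL2 P T (cpath (fun t w => a *: X t w + c *: Y t w) l).
Proof.
move=> X2 Y2.
rewrite (_ : cpath _ _ = fun t w => a * cpath X l t w + c * cpath Y l t w).
  by apply: PL2D; exact: PL2Z.
by apply/funext => t; apply/funext => w; rewrite /cpath !mxE.
Qed.

Lemma sqr_qform_PL2 m (X : pr m) : jmeasurable T X ->
  (Eint P T (fun t w => qform 1%:M (X t w)) < +oo)%E -> forall l, PL2 P T (cpath X l).
Proof.
move=> jX EX l.
have q0 t w : 0 <= qform 1%:M (X t w) by rewrite qform1E sumr_ge0 // => i _; exact: sqr_ge0.
have jq : jm T (fun t w => qform 1%:M (X t w)).
  rewrite (_ : (fun t w => _) = fun t w => \sum_i cpath X i t w ^+ 2).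
    by apply: jm_sum => i; apply: measurable_funX; exact: jX.
  by apply/funext => t; apply/funext => w; rewrite qform1E.
have Iq : PL1 P T (fun t w => qform 1%:M (X t w)).
  apply: PL1P; first exact: jq.
  rewrite (_ : (fun t w => `|_|) = fun t w => qform 1%:M (X t w)); first exact: EX.
  by apply/funext => t; apply/funext => w; rewrite ger0_norm.
apply: (PL2_ae_le (g := fun t w => qform 1%:M (X t w))) => //; first exact: jX.
apply: filterE => w t _; rewrite qform1E (bigD1 l) //= lerDl.
by apply: sumr_ge0 => i _; exact: sqr_ge0.
Qed.

Lemma sqr_qform_L2 m (Y : Omega -> 'cV[R]_m) :
  (forall l, measurable_fun setT (fun w => Y w l 0)) ->
  (\int[P]_w (qform 1%:M (Y w))%:E < +oo)%E -> forall l, L2 P setT (fun w => Y w l 0).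
Proof.
move=> mY EY l.
have q0 w : 0 <= qform 1%:M (Y w) by rewrite qform1E sumr_ge0 // => i _; exact: sqr_ge0.
have mq : measurable_fun setT (fun w => qform 1%:M (Y w)).
  rewrite (_ : (fun w => _) = fun w => \sum_i Y w i 0 ^+ 2).
    by apply: measurable_sum => i; exact: measurable_funX.
  by apply/funext => w; rewrite qform1E.
apply: (@L2_le _ _ _ _ _ _ _ (fun w => qform 1%:M (Y w))) => //.
  apply/integrableP; split; first exact/measurable_EFinP.
  rewrite (eq_integral (fun w => (qform 1%:M (Y w))%:E)) // => w _.
  by rewrite /= ger0_norm.
move=> w _; rewrite qform1E (bigD1 l) //= lerDl.
by apply: sumr_ge0 => i _; exact: sqr_ge0.
Qed.

End quadratic_functionals.

(** * Admissible inputs form a vector space *)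

Section admissible_inputs.
Context (R : realType) (d : measure_display) (Omega : measurableType d)
  (P : probability Omega R).
Variables (T : R) (T_gt0 : 0 < T) (N n k : nat).
Variables (x0 : 'I_N -> Omega -> 'cV[R]_n) (W : 'I_N -> process R Omega k).
Variable m : nat.
Local Notation U := (admissible P T x0 W (m := m)).

Lemma admissible_PL2 f : U f -> forall l, PL2 P T (cpath f l).
Proof. by move=> [jf _ Ef]; exact: sqr_qform_PL2. Qed.

Lemma admissible_comb f g a c : U f -> U g -> U (fun t w => a *: f t w + c *: g t w).
Proof.
move=> Uf Ug; have f2 := admissible_PL2 Uf; have g2 := admissible_PL2 Ug.
have fg2 l := cpathD a c (f2 l) (g2 l).
split.
- by move=> l; exact: PL2_jm (fg2 l).
- move=> t tT l.
  have [_ af _] := Uf; have [_ ag _] := Ug.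
  set S := (filtration x0 W t).
  (* Named as a generating family so that adaptedness at time t becomes measurability on
     [g_sigma_algebraType S'], which is stable under linear combinations. *)
  pose S' := gens [set: 'I_N * 'I_n] (fun p w => x0 p.1 w p.2 0) `|`
      gens [set p : R * ('I_N * 'I_k) | 0 <= p.1 <= t]
           (fun p w => W p.2.1 p.1 w p.2.2 0).
  have mf : measurable_fun setT ((fun w => f t w l 0) : g_sigma_algebraType S' -> R).
    by move=> _ Y mY; apply: (af t tT l); exists Y.
  have mg : measurable_fun setT ((fun w => g t w l 0) : g_sigma_algebraType S' -> R).
    by move=> _ Y mY; apply: (ag t tT l); exists Y.
  have mfg : measurable_fun setT
      ((fun w => a * f t w l 0 + c * g t w l 0) : g_sigma_algebraType S' -> R).
    by apply: measurable_funD; apply: measurable_funM.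
  move=> _ [Y mY <-]; have := mfg measurableT Y mY.
  have -> : (fun w => (a *: f t w + c *: g t w) l 0) = fun w => a * f t w l 0 + c * g t w l 0.
    by apply/funext => w; rewrite !mxE.
  exact.
- exact: (PL1_Eint_lty (qform_PL1 1%:M fg2)).
Qed.

(** The base point against which convexity is tested. *)
Lemma admissible0 : U (fun _ _ => 0).
Proof.
have z2 (l : 'I_m) : PL2 P T (cpath (fun _ _ => 0) l).
  rewrite (_ : cpath _ _ = fun _ _ => 0); first exact: PL2_cst0.
  by apply/funext => t; apply/funext => w; rewrite /cpath mxE.
split; last exact: (PL1_Eint_lty (qform_PL1 1%:M z2)).
- by move=> l; exact: PL2_jm (z2 l).
move=> t tT l _ [Y mY <-].
rewrite (_ : (fun w => _) = cst 0); last by apply/funext => w; rewrite mxE.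
by apply: (@measurable_cst _ _ (g_sigma_algebraType _) R setT 0).
Qed.

End admissible_inputs.

Section stacked_solutions.
Context (R : realType) (d : measure_display) (Omega : measurableType d)
  (P : probability Omega R).
Variables (T : R) (N n : nat).
Local Notation pr := (process R Omega n).

Definition stackp (x : 'I_N -> pr) : process R Omega (N * n) :=
  fun t w => stack (fun i => x i t w).

Lemma vint_stack t (b : 'I_N -> R -> 'cV[R]_n) :
  vint t (fun s => stack (fun i => b i s)) = stack (fun i => vint t (b i)).
Proof.
apply/colP => a; rewrite [in LHS]mxE [in RHS]mxE mxE.
by apply: eq_Rintegral => s _; rewrite mxE.
Qed.

Lemma solves_stack xi (b M x : 'I_N -> pr) :
  solves P T (fun w => stack (xi^~ w)) (stackp b) (stackp M) (stackp x) <->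
  forall i, solves P T (xi i) (b i) (M i) (x i).
Proof.
split=> [[jX sX] i|sx].
  split=> [l|].
    have := jX (mxtens_index (i, l)); apply: eq_measurable_fun => z _.
    by rewrite stackE.
  apply: filterS sX => w [cX eX]; split=> [l|t tT].
    have := cX (mxtens_index (i, l)).
    rewrite (_ : (fun t => _) = fun t => x i t w l 0) //.
    by apply/funext => t; rewrite stackE.
  have := congr1 (block i) (eX t tT).
  by rewrite stackK (vint_stack t (fun i s => b i s w)) !stackD stackK.
split=> [a|].
  case: (mxtens_indexP a) => i l {a}; have [+ _] := sx i => /(_ l).
  by apply: eq_measurable_fun => z _; rewrite stackE.
have /ae_forall : forall i, {ae P, forall w,
    (forall l, {within `[0, T], continuous (fun t => x i t w l 0)}) /\
    (forall t, 0 <= t <= T -> x i t w = xi i w + vint t (b i ^~ w) + M i t w)}.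
  by move=> i; case: (sx i).
apply: filterS => w H; split=> [a|t tT].
  case: (mxtens_indexP a) => i l {a}.
  rewrite (_ : (fun t => _) = fun t => x i t w l 0); first by have [] := H i.
  by apply/funext => t; rewrite stackE.
rewrite (vint_stack t (fun i s => b i s w)) !stackD; congr (stack _).
by apply/funext => i; have [_] := H i; exact.
Qed.

End stacked_solutions.

(** * Agents, controlled states and costs *)

Section agents.
Context (R : realType) (d : measure_display) (Omega : measurableType d)
  (P : probability Omega R).
Variables (T : R) (T_gt0 : 0 < T) (N n : nat).
Local Notation pr m := (process R Omega m).

Let T_ge0 : 0 <= T. Proof. exact: ltW. Qed.

Lemma avg_const z : (0 < N)%N -> avg (fun _ : 'I_N => z : 'cV[R]_n) = z.
Proof.
move=> N0; rewrite /avg sumr_const card_ord -[z *+ N]scaler_nat scalerA mulVf ?scale1r //.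
by rewrite pnatr_eq0 -lt0n.
Qed.

Lemma avg_comb (x y : 'I_N -> 'cV[R]_n) a c :
  avg (fun i => a *: x i + c *: y i) = a *: avg x + c *: avg y.
Proof.
rewrite /avg big_split /= -!scaler_sumr scalerDr !scalerA.
by rewrite [_^-1 * a]mulrC [_^-1 * c]mulrC.
Qed.

Lemma eq_solves m xi xi' (b b' M M' X X' : pr m) : xi =1 xi' ->
  b =2 b' -> M =2 M' -> X =2 X' -> solves P T xi b M X -> solves P T xi' b' M' X'.
Proof.
have funext2 (Y Y' : pr m) : Y =2 Y' -> Y = Y'.
  by move=> YY'; apply/funext => t; apply/funext => w.
by move=> /funext -> /funext2 -> /funext2 -> /funext2 ->.
Qed.

(** The coupled agents form one linear equation in R^{nN}, to which existence, uniqueness and moment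
    bounds apply at once. *)
Lemma agents_solvesP (A G : 'M[R]_n) (xi : 'I_N -> Omega -> 'cV[R]_n)
    (g M x : 'I_N -> pr n) :
  solves P T (fun w => stack (xi^~ w))
    (fun t w => Acheck N A G *m stackp x t w + stackp g t w) (stackp M) (stackp x) <->
  forall i, solves P T (xi i)
    (fun t w => A *m x i t w + G *m avg (fun j => x j t w) + g i t w) (M i) (x i).
Proof.
rewrite -(solves_stack P T xi
  (fun i t w => A *m x i t w + G *m avg (fun j => x j t w) + g i t w)).
rewrite (_ : (fun t w => _ + _) = stackp (fun i t w =>
   A *m x i t w + G *m avg (fun j => x j t w) + g i t w)) //.
by apply/funext => t; apply/funext => w; rewrite /stackp Acheck_stack stackD.
Qed.

Lemma pathL1_comb m (g h : pr m) a c : pathL1 P T g -> pathL1 P T h ->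
  pathL1 P T (fun t w => a *: g t w + c *: h t w).
Proof.
apply: filterS2 => w gw hw l.
rewrite (_ : (fun t => _) = fun t => a * g t w l 0 + c * h t w l 0).
  by apply: L1D => //; exact: L1Z.
by apply/funext => t; rewrite !mxE.
Qed.

(** Once the average is regarded as a given input, all agents solve the same equation with matrix
    [A]; uniqueness makes them equal, and the average is then any one of them. *)
Lemma agents_collapse (A G : 'M[R]_n) (f : pr n) (y : 'I_N -> pr n) :
  (0 < N)%N -> pathL1 P T f ->
  (forall i, solves P T (fun=> 0)
     (fun t w => A *m y i t w + G *m avg (fun j => y j t w) + f t w) (fun _ _ => 0) (y i)) ->
  {ae P, forall w, forall t, 0 <= t <= T -> forall i j, y i t w = y j t w} /\
  forall i, solves P T (fun=> 0)
     (fun t w => (A + G) *m y i t w + f t w) (fun _ _ => 0) (y i).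
Proof.
move=> N0 If sy.
(* The mean-field term together with [f]: the input shared by all agents. *)
pose g : pr n := fun t w => G *m avg (fun j => y j t w) + f t w.
have sy' i : solves P T (fun=> 0) (fun t w => A *m y i t w + g t w) (fun _ _ => 0) (y i).
  rewrite (_ : (fun t w => _) =
    fun t w => A *m y i t w + G *m avg (fun j => y j t w) + f t w) //.
  by apply/funext => t; apply/funext => w; rewrite /g addrA.
have Ig : pathL1 P T g.
  have /ae_forall : forall i, {ae P, forall w, contw T (y i) w}.
    by move=> i; have [_] := sy i; apply: filterS => w [].
  apply: filterS2 If => w Ifw cy l.
  rewrite (_ : (fun t => _) = fun t =>
    \sum_k G l k * (N%:R^-1 * \sum_j y j t w k 0) + f t w l 0); last first.
    apply/funext => t; rewrite !mxE; congr (_ + _); apply: eq_bigr => k _.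
    by rewrite mxE summxE.
  apply: L1D => //; apply: continuous_integrable (lexx T).
  apply: within_continuous_sum => k; apply: within_continuousM; first by move=> x; exact: cvg_cst.
  apply: within_continuousM; first by move=> x; exact: cvg_cst.
  by apply: within_continuous_sum => j; exact: cy.
have yy : {ae P, forall w, forall t, 0 <= t <= T -> forall i j, y i t w = y j t w}.
  have /ae_forall H : forall p : 'I_N * 'I_N,
      {ae P, forall w, forall t, 0 <= t <= T -> y p.1 t w = y p.2 t w}.
    by move=> p; exact: (solves_unique T_gt0 Ig (sy' p.1) (sy' p.2)).
  by apply: filterS H => w H t tT i j; exact: (H (i, j) t tT).
split=> [|i]; first exact: yy.
apply: (solves_ae _ _ (sy i)); first by case: (sy i).
apply: filterS yy => w yw t tT; split=> //.
rewrite (_ : avg _ = y i t w); first by rewrite mulmxDl.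
rewrite -[RHS]avg_const //; congr avg; apply/funext => j; exact: yw.
Qed.

End agents.

(** * States of the controlled system *)

Section controlled_states.
Context (R : realType) (d : measure_display) (Omega : measurableType d)
  (P : probability Omega R).
Variables (T : R) (T_gt0 : 0 < T) (N n r k : nat).
Variables (A G : 'M[R]_n) (B : 'M[R]_(n, r)) (sigma : 'M[R]_(n, k)).
Variables (x0 : 'I_N -> Omega -> 'cV[R]_n) (W : 'I_N -> process R Omega k).
Variable u : 'I_N -> process R Omega r.
Hypothesis noise : noise_model P x0 W.
Hypothesis u_adm : forall i, admissible P T x0 W (u i).
Local Notation pr m := (process R Omega m).
Local Notation U := (admissible P T x0 W (m := n)).
Local Notation is_state := (is_state P T A G B sigma x0 W u).

Let T_ge0 : 0 <= T. Proof. exact: ltW. Qed.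

Definition input (f : pr n) : 'I_N -> pr n := fun i t w => B *m u i t w + f t w.
Definition diffusion : 'I_N -> pr n := fun i t w => sigma *m W i t w.

Lemma is_stateP f x : is_state f x <->
  solves P T (fun w => stack (x0^~ w))
    (fun t w => Acheck N A G *m stackp x t w + stackp (input f) t w)
    (stackp diffusion) (stackp x).
Proof.
rewrite agents_solvesP /Defs.is_state.
have E i : (fun t w => A *m x i t w + B *m u i t w + G *m avg (fun j => x j t w) + f t w) =
  (fun t w => A *m x i t w + G *m avg (fun j => x j t w) + input f i t w).
  apply/funext => t; apply/funext => w; rewrite /input !addrA.
  by congr (_ + _); rewrite addrAC.
by split=> sx i; have := sx i; rewrite E.
Qed.

Lemma input_PL2 f : U f -> forall a, PL2 P T (cpath (stackp (input f)) a).
Proof.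
move=> Uf a; case: (mxtens_indexP a) => i l {a}.
have f2 := admissible_PL2 Uf.
have u2 := admissible_PL2 (u_adm i).
rewrite (_ : cpath _ _ = fun t w => cpath (fun t w => B *m u i t w) l t w + cpath f l t w).
  by apply: PL2D => //; exact: cpath_lin.
by apply/funext => t; apply/funext => w; rewrite /cpath stackE mxE.
Qed.

(** Continuity on every path is needed to construct and bound states. Agreement at all times outside
    one null set lets solutions pass between the two noises through [solves_ae]. *)
Lemma diffusion_version : exists M : pr (N * n),
  [/\ forall w, contw T M w, forall a, PL2 P T (cpath M a),
      forall a, L2 P setT (cpath M a T) &
      {ae P, forall w, forall t, stackp diffusion t w = M t w}].
Proof.
have [bW _ _ _ _] := noise.
have [W' W'P] := fin_all_exists (fun i => brownian_version T_gt0 (bW i)).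
exists (stackp (fun i t w => sigma *m W' i t w)); split.
- move=> w a; case: (mxtens_indexP a) => i l {a}.
  rewrite (_ : (fun t => _) = fun t => \sum_j sigma l j * W' i t w j 0).
    apply: within_continuous_sum => j; apply: within_continuousM.
      by move=> x; exact: cvg_cst.
    by case: (W'P i).
  by apply/funext => t; rewrite stackE mxE.
- move=> a; case: (mxtens_indexP a) => i l {a}.
  rewrite (_ : cpath _ _ = cpath (fun t w => sigma *m W' i t w) l).
    by apply: cpath_lin; case: (W'P i).
  by apply/funext => t; apply/funext => w; rewrite /cpath stackE.
- move=> a; case: (mxtens_indexP a) => i l {a}.
  rewrite (_ : cpath _ _ _ = fun w => (sigma *m W' i T w) l 0).
    by apply: L2_lin; case: (W'P i).
  by apply/funext => w; rewrite /cpath stackE.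
- have /ae_forall : forall i, {ae P, forall w, forall t, W i t w = W' i t w}.
    by move=> i; case: (W'P i).
  apply: filterS => w H t; rewrite /stackp; congr (stack _).
  by apply/funext => i; rewrite /diffusion H.
Qed.

Lemma initial_L2 a : L2 P setT (fun w => stack (x0^~ w) a 0).
Proof.
case: (mxtens_indexP a) => i l {a}; have [_ mx0 Ex0 _ _] := noise.
rewrite (_ : (fun w => _) = fun w => x0 i w l 0).
  exact: (sqr_qform_L2 (mx0 i) (Ex0 i)).
by apply/funext => w; rewrite stackE.
Qed.

Lemma state_exists f : U f -> exists x, is_state f x.
Proof.
move=> Uf; have [M [cM M2 MT2 aeM]] := diffusion_version.
have g2 := input_PL2 Uf.
have [X sX] := solves_exists T_gt0 (Acheck N A G) (fun a => (initial_L2 a).1)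
  (fun a => PL2_jm (g2 a)) (PL2_pathL1 T_gt0 g2) (fun a => PL2_jm (M2 a)) cM.
exists (fun i t w => block i (X t w)); apply/is_stateP.
have XE : stackp (fun i t w => block i (X t w)) = X.
  by apply/funext => t; apply/funext => w; exact: blockK.
rewrite XE; apply: (solves_ae _ _ sX); first by case: sX.
by apply: filterS aeM => w H t _; split.
Qed.

Lemma state_sqint f x : U f -> is_state f x -> forall i, sqint P T (x i).
Proof.
move=> Uf /is_stateP sx i; have [M [cM M2 MT2 aeM]] := diffusion_version.
have sx' : solves P T (fun w => stack (x0^~ w))
    (fun t w => Acheck N A G *m stackp x t w + stackp (input f) t w) M (stackp x).
  apply: (solves_ae _ _ sx); first by case: sx.
  by apply: filterS aeM => w H t _; split.
have X2 := solves_L2 T_gt0 initial_L2 (input_PL2 Uf) M2 MT2 cM sx'.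
split=> l; have [H1 H2] := X2 (mxtens_index (i, l)).
  rewrite (_ : cpath _ _ = cpath (stackp x) (mxtens_index (i, l))) //.
  by apply/funext => t; apply/funext => w; rewrite /cpath stackE.
rewrite (_ : cpath _ _ _ = cpath (stackp x) (mxtens_index (i, l)) T) //.
by apply/funext => w; rewrite /cpath stackE.
Qed.

(** Existence rules out the default value of [xget]. *)
Lemma stateP f : U f -> is_state f (state P T A G B sigma x0 W u f).
Proof. by move=> /state_exists; exact: xgetPex. Qed.

(** Superposition with weights 1 and -1: initial states, controls and noise are common to both
    systems and cancel. *)
Lemma state_diff f g x y : U f -> U g -> is_state f x -> is_state g y ->
  forall i, solves P T (fun=> 0)
    (fun t w => A *m (x i t w - y i t w) + G *m avg (fun j => x j t w - y j t w) +
       (f t w - g t w))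
    (fun _ _ => 0) (fun t w => x i t w - y i t w).
Proof.
move=> Uf Ug /is_stateP sx /is_stateP sy.
have If := PL2_pathL1 T_gt0 (input_PL2 Uf).
have Ig := PL2_pathL1 T_gt0 (input_PL2 Ug).
have E (z v : 'I_N -> 'cV[R]_n) : 1 *: stack z + (-1) *: stack v = stack (fun i => z i - v i).
  by rewrite !stackZ stackD; congr (stack _); apply/funext => i; rewrite scale1r scaleN1r.
have := solves_comb 1 (-1) If Ig sx sy.
move=> H; apply/(agents_solvesP P T A G (fun _ _ => 0) (fun i t w => f t w - g t w)
  (fun _ _ _ => 0) (fun i t w => x i t w - y i t w)).
apply: eq_solves H => [w|t w|t w|t w]; rewrite /stackp ?E //.
- by congr (stack _); apply/funext => i; rewrite subrr.
- congr (_ + stack _); apply/funext => i.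
  by rewrite /input opprD addrACA subrr add0r.
- by congr (stack _); apply/funext => i; rewrite subrr.
Qed.

(** The weights add up to 1, so the mixture of states has the original initial states, controls and
    noise, hence is a state for the mixed input; uniqueness identifies it with [z]. *)
Lemma state_comb f g h x y z lam : U f -> U g ->
  h =2 (fun t w => lam *: f t w + (1 - lam) *: g t w) ->
  is_state f x -> is_state g y -> is_state h z ->
  {ae P, forall w, forall t, 0 <= t <= T -> forall i,
    z i t w = lam *: x i t w + (1 - lam) *: y i t w}.
Proof.
move=> Uf Ug hE /is_stateP sx /is_stateP sy /is_stateP sz.
have If := PL2_pathL1 T_gt0 (input_PL2 Uf).
have Ig := PL2_pathL1 T_gt0 (input_PL2 Ug).
have E (v v' : 'I_N -> 'cV[R]_n) : lam *: stack v + (1 - lam) *: stack v' =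
    stack (fun i => lam *: v i + (1 - lam) *: v' i).
  by rewrite !stackZ stackD.
have id_comb (v : 'cV[R]_n) : lam *: v + (1 - lam) *: v = v.
  by rewrite -scalerDl addrC subrK scale1r.
have := solves_comb lam (1 - lam) If Ig sx sy.
move=> H; have Ih := pathL1_comb lam (1 - lam) If Ig.
have {}H : solves P T (fun w => stack (x0^~ w))
    (fun t w => Acheck N A G *m stackp (fun i t w => lam *: x i t w + (1 - lam) *: y i t w) t w
      + (lam *: stackp (input f) t w + (1 - lam) *: stackp (input g) t w))
    (stackp diffusion) (stackp (fun i t w => lam *: x i t w + (1 - lam) *: y i t w)).
  apply: eq_solves H => [w|t w|t w|t w]; rewrite /stackp ?E //.
  - by congr (stack _); apply/funext => i; rewrite id_comb.
  - by congr (stack _); apply/funext => i; rewrite id_comb.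
have {}sz : solves P T (fun w => stack (x0^~ w))
    (fun t w => Acheck N A G *m stackp z t w
      + (lam *: stackp (input f) t w + (1 - lam) *: stackp (input g) t w))
    (stackp diffusion) (stackp z).
  apply: eq_solves sz => // t w; congr (_ + _); rewrite /stackp E.
  congr (stack _); apply/funext => i; rewrite /input hE !scalerDr addrACA id_comb.
  by [].
apply: filterS (solves_unique T_gt0 Ih sz H) => w Hw t tT i.
by have := congr1 (block i) (Hw t tT); rewrite !stackK.
Qed.

End controlled_states.

(** * The quadratic cost and its exact convexity gap *)

Section costs.
Context (R : realType) (d : measure_display) (Omega : measurableType d)
  (P : probability Omega R).
Variables (T : R) (T_gt0 : 0 < T) (n : nat).
Variables (Q R2 H : 'M[R]_n).
Local Notation pr m := (process R Omega m).

Definition L2process (X : pr n) := forall l, PL2 P T (cpath X l).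
Definition L2vector (Y : Omega -> 'cV[R]_n) := forall l, L2 P setT (fun w => Y w l 0).

Definition running (v f : pr n) t w := - qform Q (v t w) + qform R2 (f t w).

(** One functional for both the agent costs and the defect. The terminal vector [Y] is separate from
    [v] since the running term sees a tracking error and the terminal term the state itself. *)
Definition cost (v f : pr n) (Y : Omega -> 'cV[R]_n) : \bar R :=
  (Eint P T (running v f) - \int[P]_w (qform H (Y w))%:E)%E.

Lemma running_PL1 v f : L2process v -> L2process f -> PL1 P T (running v f).
Proof.
move=> v2 f2; have := PL1D (PL1Z (-1) (qform_PL1 Q v2)) (qform_PL1 R2 f2).
rewrite (_ : (fun t w => _) = running v f) //.
by apply/funext => t; apply/funext => w; rewrite /running mulN1r.
Qed.

Lemma terminalE Y : L2vector Y ->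
  (\int[P]_w (qform H (Y w))%:E = (\int[P]_w qform H (Y w))%:E)%E.
Proof.
move=> Y2; rewrite /Rintegral fineK //.
by apply: integrable_fin_num => //; exact: qform_L1.
Qed.

Lemma cost_fin_num v f Y : L2process v -> L2process f -> L2vector Y ->
  cost v f Y \is a fin_num.
Proof.
move=> v2 f2 Y2; rewrite /cost terminalE // fin_numB Eint_fin_num //.
exact: running_PL1.
Qed.

Lemma eq_cost v f Y v' f' Y' :
  L2process v -> L2process f -> L2vector Y ->
  L2process v' -> L2process f' -> L2vector Y' ->
  {ae P, forall w, forall t, 0 <= t <= T -> v t w = v' t w} ->
  {ae P, forall w, forall t, 0 <= t <= T -> f t w = f' t w} ->
  {ae P, forall w, Y w = Y' w} -> cost v f Y = cost v' f' Y'.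
Proof.
move=> v2 f2 Y2 v2' f2' Y2' vv ff YY; rewrite /cost.
have -> : Eint P T (running v f) = Eint P T (running v' f').
  apply: eq_Eint; [exact: PL1_jm (running_PL1 v2 f2)|exact: PL1_jm (running_PL1 v2' f2')|].
  by apply: filterS2 vv ff => w vw fw t tT; rewrite /running vw // fw.
suff -> : (\int[P]_w (qform H (Y w))%:E = \int[P]_w (qform H (Y' w))%:E)%E by [].
apply: ae_eq_integral; first exact: measurableT.
- by apply/measurable_EFinP; exact: L1_meas (qform_L1 H Y2).
- by apply/measurable_EFinP; exact: L1_meas (qform_L1 H Y2').
- by apply: filterS YY => w -> _.
Qed.

(** [qform_comb] under both integrals. All four costs are finite, so the identity is stated between
    reals through [fine]. *)
Lemma cost_comb lam v f Y v' f' Y' :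
  L2process v -> L2process f -> L2vector Y ->
  L2process v' -> L2process f' -> L2vector Y' ->
  let c := cost v f Y in let c' := cost v' f' Y' in
  let c'' := cost (fun t w => lam *: v t w + (1 - lam) *: v' t w)
    (fun t w => lam *: f t w + (1 - lam) *: f' t w)
    (fun w => lam *: Y w + (1 - lam) *: Y' w) in
  let delta := cost (fun t w => v t w - v' t w) (fun t w => f t w - f' t w)
    (fun w => Y w - Y' w) in
  fine c'' = lam * fine c + (1 - lam) * fine c' - lam * (1 - lam) * fine delta.
Proof.
move=> v2 f2 Y2 v2' f2' Y2' /=.
have sub (X X' : pr n) : L2process X -> L2process X' -> L2process (fun t w => X t w - X' t w).
  move=> X2 X2' l; have := cpathD 1 (-1) (X2 l) (X2' l).
  rewrite (_ : (fun t w => _) = fun t w => X t w - X' t w) //.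
  by apply/funext => t; apply/funext => w; rewrite scale1r scaleN1r.
have comb (X X' : pr n) : L2process X -> L2process X' ->
    L2process (fun t w => lam *: X t w + (1 - lam) *: X' t w).
  by move=> X2 X2' l; exact: cpathD.
have Ycomb a b : L2vector (fun w => a *: Y w + b *: Y' w).
  move=> l; rewrite (_ : (fun w => _) = fun w => a * Y w l 0 + b * Y' w l 0).
    by apply: L2D => //; exact: L2Z.
  by apply/funext => w; rewrite !mxE.
have Ysub : L2vector (fun w => Y w - Y' w).
  rewrite (_ : (fun w => _) = fun w => 1 *: Y w + (-1) *: Y' w); first exact: Ycomb.
  by apply/funext => w; rewrite scale1r scaleN1r.
pose dv : pr n := fun t w => v t w - v' t w; pose df : pr n := fun t w => f t w - f' t w.
pose vc : pr n := fun t w => lam *: v t w + (1 - lam) *: v' t w.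
pose fc : pr n := fun t w => lam *: f t w + (1 - lam) *: f' t w.
have Ir := running_PL1 v2 f2; have Ir' := running_PL1 v2' f2'.
have Ird : PL1 P T (running dv df) by apply: running_PL1; exact: sub.
have HY := qform_L1 H Y2; have HY' := qform_L1 H Y2'; have HYd := qform_L1 H Ysub.
have rE : Eint P T (running vc fc) = (lam%:E * Eint P T (running v f) +
    (1 - lam)%:E * Eint P T (running v' f') +
    (- (lam * (1 - lam)))%:E * Eint P T (running dv df))%E.
  have If := PL1Z lam Ir; have If' := PL1Z (1 - lam) Ir'.
  have Id := PL1Z (- (lam * (1 - lam))) Ird.
  rewrite -(EintZ _ Ir) -(EintZ _ Ir') -(EintZ _ Ird) -(EintD If If') -(EintD (PL1D If If') Id).
  congr (Eint P T _); apply/funext => t; apply/funext => w.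
  by rewrite /running !qform_comb /dv /df; ring.
have tE : \int[P]_w qform H (lam *: Y w + (1 - lam) *: Y' w) =
    lam * \int[P]_w qform H (Y w) + (1 - lam) * \int[P]_w qform H (Y' w) +
    (- (lam * (1 - lam))) * \int[P]_w qform H (Y w - Y' w).
  rewrite -!RintegralZl // -!RintegralD //; try by do ?[exact: L1Z | apply: L1D].
  by apply: eq_Rintegral => w _; rewrite qform_comb; ring.
rewrite /cost !terminalE // -/dv -/df -/vc -/fc rE tE.
move: (Eint_fin_num Ir) (Eint_fin_num Ir') (Eint_fin_num Ird).
move: (Eint P T (running v f)) (Eint P T (running v' f')) (Eint P T (running dv df)).
move: (\int[P]_w qform H (Y w)) (\int[P]_w qform H (Y' w)) (\int[P]_w qform H (Y w - Y' w)).
by move=> p p' pd [e| |] // [e'| |] // [ed| |] // _ _ _ /=; ring.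
Qed.

End costs.

(** * The three characterizations *)

Section characterizations.
Context (R : realType) (disp : measure_display) (Omega : measurableType disp)
  (P : probability Omega R).
Variables (T : R) (T_gt0 : 0 < T) (N n r d : nat) (N_ge1 : (0 < N)%N).
Variables (A G Gam : 'M[R]_n) (B : 'M[R]_(n, r)) (sigma : 'M[R]_(n, d)).
Variables (eta : 'cV[R]_n) (Q R2 H : 'M[R]_n).
Variables (x0 : 'I_N -> Omega -> 'cV[R]_n) (W : 'I_N -> process R Omega d).
Variable u : 'I_N -> process R Omega r.
Hypothesis noise : noise_model P x0 W.
Hypothesis u_adm : forall i, admissible P T x0 W (u i).
Local Notation pr m := (process R Omega m).
Local Notation U := (admissible P T x0 W (m := n)).
Local Notation state f := (state P T A G B sigma x0 W u f).
Local Notation L2process := (L2process P T).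
Local Notation L2vector := (L2vector P).

Let T_ge0 : 0 <= T. Proof. exact: ltW. Qed.

Definition mean_solution (f z : pr n) :=
  solves P T (fun=> 0) (fun t w => (A + G) *m z t w + f t w) (fun _ _ => 0) z.

Definition defect (f z : pr n) : \bar R :=
  cost P T Q R2 H (fun t w => (1%:M - Gam) *m z t w) f (z T).

(** The common form of the three statements. Quantifying over every solution matches (ii) and (iii);
    for (i), uniqueness compares an arbitrary solution with the one arising from states. *)
Definition mean_field_positivity :=
  forall f, U f -> forall z, mean_solution f z -> (0 <= defect f z)%E.

Lemma null_solves_L2 m (K : 'M[R]_m) (g X : pr m) :
  (forall l, PL2 P T (cpath g l)) ->
  solves P T (fun=> 0) (fun t w => K *m X t w + g t w) (fun _ _ => 0) X -> sqint P T X.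
Proof.
move=> g2 sX.
have c0 : cpath ((fun _ _ => 0) : pr m) = fun _ _ _ => 0.
  by apply/funext => l; apply/funext => t; apply/funext => w; rewrite /cpath mxE.
have zero2 : L2 P setT (fun=> 0 : R) by exact: L2_0.
have X2 : forall l, PL2 P T (cpath X l) /\ L2 P setT (cpath X l T).
  apply: solves_L2 sX => // [l|l|l|w l].
  - by rewrite (_ : (fun=> _) = fun=> 0) //; apply/funext => w; rewrite mxE.
  - by rewrite c0; exact: PL2_cst0.
  - by rewrite c0.
  - by move=> x; exact: cvg_cst.
by split=> l; case: (X2 l).
Qed.

Lemma mean_sqint f z : U f -> mean_solution f z -> sqint P T z.
Proof. by move=> Uf; apply: null_solves_L2; exact: (admissible_PL2 Uf). Qed.

Lemma admissible_pathL1 f : U f -> pathL1 P T f.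
Proof. by move=> Uf; apply: (PL2_pathL1 T_gt0); exact: (admissible_PL2 Uf). Qed.

Lemma defect_fin_num f z : U f -> sqint P T z -> defect f z \is a fin_num.
Proof.
move=> Uf [z2 zT2]; apply: cost_fin_num => //.
- by move=> l; exact: cpath_lin.
- exact: (admissible_PL2 Uf).
Qed.

(** Conversely to [agents_collapse], N copies of a mean solution solve the agents' system, since
    their average is the solution itself. *)
Lemma agents_positivityP :
  (forall f, U f -> forall y : 'I_N -> pr n,
    (forall i, solves P T (fun=> 0)
      (fun t w => A *m y i t w + G *m avg (fun j => y j t w) + f t w)
      (fun _ _ => 0) (y i)) ->
    forall i, (0 <= defect f (y i))%E) <-> mean_field_positivity.
Proof.
split=> [pos f Uf z sz|pos f Uf y sy i].
  apply: (pos f Uf (fun=> z) _ (Ordinal N_ge1)) => _.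
  apply: eq_solves sz => // t w.
  by rewrite avg_const // mulmxDl.
have [_ sy'] := agents_collapse T_gt0 N_ge1 (admissible_pathL1 Uf) sy.
exact: (pos f Uf _ (sy' i)).
Qed.

Definition stacked_defect (f : pr n) (y : pr (N * n)) : \bar R :=
  (Eint P T (fun t w => - qform (Qhat N Q Gam) (y t w) + N%:R * qform R2 (f t w))%R
     - \int[P]_w (qform (blkdiag N H) (y T w))%:E)%E.

Definition stacked_solution (f : pr n) (y : pr (N * n)) :=
  solves P T (fun _ => 0)
    (fun t w => Acheck N A G *m y t w + ones_tens N (f t w)) (fun _ _ => 0) y.

Lemma stacked_solutionP f (y : 'I_N -> pr n) : stacked_solution f (stackp y) <->
  forall i, solves P T (fun=> 0)
    (fun t w => A *m y i t w + G *m avg (fun j => y j t w) + f t w) (fun _ _ => 0) (y i).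
Proof.
rewrite -(agents_solvesP P T A G (fun _ _ => 0) (fun _ => f) (fun _ _ _ => 0)).
split; apply: eq_solves => [w|t w|t w|t w]; by rewrite /stackp ?ones_tensE ?stack0.
Qed.

Lemma stacked_defectE f y z : U f -> stacked_solution f y -> sqint P T z ->
  {ae P, forall w, forall t, 0 <= t <= T -> y t w = stack (fun=> z t w)} ->
  stacked_defect f y = (N%:R%:E * defect f z)%E.
Proof.
move=> Uf sy [z2 zT2] yz.
have f2 := admissible_PL2 Uf.
have [y2 yT2] : sqint P T y.
  apply: null_solves_L2 sy => a; case: (mxtens_indexP a) => i l {a}.
  rewrite (_ : cpath _ _ = cpath f l) //.
  by apply/funext => t; apply/funext => w; rewrite /cpath ones_tensE stackE.
have v2 : L2process (fun t w => (1%:M - Gam) *m z t w) by move=> l; exact: cpath_lin.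
have Irun := running_PL1 Q R2 v2 f2.
have Hz := qform_L1 H zT2.
rewrite /stacked_defect /defect /cost.
have -> : Eint P T (fun t w => - qform (Qhat N Q Gam) (y t w) + N%:R * qform R2 (f t w)) =
    (N%:R%:E * Eint P T (running Q R2 (fun t w => (1%:M - Gam) *m z t w) f))%E.
  rewrite -(EintZ _ Irun); apply: eq_Eint.
  - have I1 := PL1D (PL1Z (-1) (qform_PL1 (Qhat N Q Gam) y2)) (PL1Z N%:R (qform_PL1 R2 f2)).
    have := PL1_jm I1.
    rewrite (_ : (fun t w => _) =
      fun t w => - qform (Qhat N Q Gam) (y t w) + N%:R * qform R2 (f t w)) //.
    by apply/funext => t; apply/funext => w; rewrite mulN1r.
  - exact: PL1_jm (PL1Z _ Irun).
  - apply: filterS yz => w yzw t tT.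
    by rewrite /running yzw // qform_Qhat_const // mulrDr mulrN.
have -> : (\int[P]_w (qform (blkdiag N H) (y T w))%:E)%E =
    (N%:R%:E * \int[P]_w (qform H (z T w))%:E)%E.
  rewrite -integralZl //; apply: ae_eq_integral => //.
  - by apply/measurable_EFinP; exact: L1_meas (qform_L1 _ yT2).
  - by apply/measurable_EFinP; exact: L1_meas (L1Z _ N%:R Hz).
  - apply: filterS yz => w yzw _; rewrite -EFinM yzw ?T_ge0 ?lexx //.
    by rewrite qform_blkdiag_const.
(* Both terms are finite, so the factor N distributes over the difference. *)
rewrite terminalE //; move: (Eint_fin_num Irun).
move: (Eint _ _ _) (Rintegral _ _ _) => [a| |] b // _.
by change ((N%:R * a - N%:R * b)%:E = (N%:R * (a - b))%:E); rewrite mulrBr.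
Qed.

(** By [stacked_defectE] the two defects differ by the factor N > 0, which preserves the sign. *)
Lemma stacked_positivityP :
  (forall f, U f -> forall y, stacked_solution f y -> (0 <= stacked_defect f y)%E) <->
  mean_field_positivity.
Proof.
have Ngt0 : (0 : R) < N%:R by rewrite ltr0n.
split=> [pos f Uf z sz|pos f Uf y sy].
  have sy : stacked_solution f (stackp (fun _ : 'I_N => z)).
    apply/stacked_solutionP => _; apply: eq_solves sz => // t w.
    by rewrite avg_const // mulmxDl.
  have := pos f Uf _ sy; rewrite (stacked_defectE Uf sy (mean_sqint Uf sz)).
    by rewrite pmule_rge0 // lte_fin.
  exact: filterE.
pose yb i : pr n := fun t w => block i (y t w).
have yE : y = stackp yb by apply/funext => t; apply/funext => w; rewrite /stackp blockK.
have sy' := sy; rewrite yE in sy'; move/stacked_solutionP : sy' => sy'.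
have [yy sm] := agents_collapse T_gt0 N_ge1 (admissible_pathL1 Uf) sy'.
have sz := sm (Ordinal N_ge1).
rewrite (stacked_defectE Uf sy (mean_sqint Uf sz)).
  by apply: mule_ge0; [rewrite lee_fin ltW|exact: (pos f Uf _ sz)].
apply: filterS yy => w yw t tT; rewrite {1}yE /stackp.
by congr (stack _); apply/funext => i; exact: yw.
Qed.

Definition tracking (x : 'I_N -> pr n) i : pr n :=
  fun t w => x i t w - Gam *m avg (fun j => x j t w) - eta.

Definition agent_cost (f : pr n) (x : 'I_N -> pr n) i : \bar R :=
  cost P T Q R2 H (tracking x i) f (x i T).

Lemma tracking_L2 (x : 'I_N -> pr n) i : (forall j, sqint P T (x j)) ->
  L2process (tracking x i).
Proof.
move=> x2 l.
have avg2 k : PL2 P T (cpath (fun t w => avg (fun j => x j t w)) k).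
  rewrite (_ : cpath _ _ = fun t w => N%:R^-1 * \sum_j cpath (x j) k t w).
    by apply: PL2Z; apply: PL2_sum => j; case: (x2 j).
  by apply/funext => t; apply/funext => w; rewrite /cpath /avg mxE summxE.
have eta2 : PL2 P T (cpath (fun _ _ => eta) l) by exact: PL2_cst.
have [xi2 _] := x2 i.
have := PL2D (PL2D (xi2 l) (PL2Z (-1) (cpath_lin Gam l avg2))) (PL2Z (-1) eta2).
rewrite (_ : (fun t w => _) = cpath (tracking x i) l) //.
by apply/funext => t; apply/funext => w; rewrite /cpath !mxE !mulN1r.
Qed.

Lemma agent_cost_fin_num f x i : L2process f -> (forall j, sqint P T (x j)) ->
  agent_cost f x i \is a fin_num.
Proof.
move=> f2 x2; apply: cost_fin_num => //; first exact: tracking_L2.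
by case: (x2 i).
Qed.

(** The gap is the same for every agent [i]: [eta] cancels in the difference of tracking errors, and
    the average of the differences is again [z], leaving (I - Gam) z. *)
Lemma agent_cost_comb f g z lam i (x y v : 'I_N -> pr n) :
  L2process f -> L2process g -> sqint P T z ->
  (forall j, sqint P T (x j)) -> (forall j, sqint P T (y j)) ->
  (forall j, sqint P T (v j)) ->
  {ae P, forall w, forall t, 0 <= t <= T -> forall j,
     v j t w = lam *: x j t w + (1 - lam) *: y j t w} ->
  {ae P, forall w, forall t, 0 <= t <= T -> forall j, x j t w - y j t w = z t w} ->
  fine (agent_cost (fun t w => lam *: f t w + (1 - lam) *: g t w) v i) =
  lam * fine (agent_cost f x i) + (1 - lam) * fine (agent_cost g y i)
    - lam * (1 - lam) * fine (defect (fun t w => f t w - g t w) z).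
Proof.
move=> f2 g2 [z2 zT2] x2 y2 v2 mix xyz.
have xT : L2vector (x i T) by case: (x2 i).
have yT : L2vector (y i T) by case: (y2 i).
have vT : L2vector (v i T) by case: (v2 i).
have tx := tracking_L2 i x2; have ty := tracking_L2 i y2; have tv := tracking_L2 i v2.
have L2T a b : L2vector (fun w => a *: x i T w + b *: y i T w).
  move=> l; rewrite (_ : (fun w => _) = fun w => a * x i T w l 0 + b * y i T w l 0).
    by apply: L2D => //; exact: L2Z.
  by apply/funext => w; rewrite !mxE.
have sub (X Y : pr n) : (fun t w => X t w - Y t w) = fun t w => 1 *: X t w + (-1) *: Y t w.
  by apply/funext => t; apply/funext => w; rewrite scale1r scaleN1r.
have c2 : L2process (fun t w => lam *: f t w + (1 - lam) *: g t w).
  by move=> l; exact: cpathD.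
have d2 : L2process (fun t w => f t w - g t w) by rewrite sub => l; exact: cpathD.
(* The tracking error is affine in the states, and the weights sum to 1, so the constant [eta] is
   reproduced by the mixture. *)
rewrite (_ : agent_cost _ v i = cost P T Q R2 H
  (fun t w => lam *: tracking x i t w + (1 - lam) *: tracking y i t w)
  (fun t w => lam *: f t w + (1 - lam) *: g t w)
  (fun w => lam *: x i T w + (1 - lam) *: y i T w)); last first.
  apply: eq_cost => //.
  - by move=> l; exact: cpathD.
  - apply: filterS mix => w mixw t tT; rewrite /tracking.
    rewrite (_ : avg _ = lam *: avg (fun j => x j t w) + (1 - lam) *: avg (fun j => y j t w)).
      rewrite mixw // mulmxDr -!scalemxAr.
      by apply/colP => l; rewrite !mxE; ring.
    by rewrite -avg_comb; congr avg; apply/funext => j; exact: mixw.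
  - by apply: filterE.
  - by apply: filterS mix => w mixw; apply: mixw; rewrite T_ge0 lexx.
rewrite (cost_comb Q R2 H lam tx f2 xT ty g2 yT); congr (_ - _ * fine _).
apply: eq_cost => //.
- by rewrite sub => l; exact: cpathD.
- rewrite (_ : (fun w => _) = fun w => 1 *: x i T w + (-1) *: y i T w) //.
  by apply/funext => w; rewrite scale1r scaleN1r.
- by move=> l; exact: cpath_lin.
- apply: filterS xyz => w xw t tT.
  (* All differences equal [z], so their average does too. *)
  have av : avg (fun j => x j t w) - avg (fun j => y j t w) = z t w.
    rewrite -[RHS](avg_const _ N_ge1) -[X in X - _]scale1r -scaleN1r -avg_comb.
    by congr avg; apply/funext => j; rewrite scale1r scaleN1r xw.
  rewrite /tracking mulmxBl mul1mx -{1}(xw t tT i) -av mulmxBr.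
  move: (Gam *m _) (Gam *m _) => af ag.
  by apply/colP => l; rewrite !mxE; ring.
- by apply: filterE.
- by apply: filterS xyz => w xw; apply: xw; rewrite T_ge0 lexx.
Qed.

(** Finiteness of each agent's cost turns the convexity inequality into one between real numbers. *)
Lemma JsocE f : U f -> Jsoc P T A G Gam B sigma eta Q R2 H x0 W u f =
  (2^-1 * \sum_i fine (agent_cost f (state f) i))%:E.
Proof.
move=> Uf; have x2 := state_sqint T_gt0 noise u_adm Uf (stateP T_gt0 A G B sigma noise u_adm Uf).
rewrite EFinM -sumEFin; congr (_ * _)%E; apply: eq_bigr => i _.
by rewrite fineK //; apply: agent_cost_fin_num => //; exact: (admissible_PL2 Uf).
Qed.

Lemma convexityP :
  convex_functional U (Jsoc P T A G Gam B sigma eta Q R2 H x0 W u) <-> mean_field_positivity.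
Proof.
have i0 := Ordinal N_ge1.
have Ngt0 : (0 : R) < N%:R by rewrite ltr0n.
pose J := Jsoc P T A G Gam B sigma eta Q R2 H x0 W u.
(* From here [state] and [Jsoc] are used only through these three facts. *)
have [X [Xs X2 JE]] : exists X : pr n -> 'I_N -> pr n,
    [/\ forall f, U f -> is_state P T A G B sigma x0 W u f (X f),
      forall f, U f -> forall i, sqint P T (X f i) &
      forall f, U f -> J f = (2^-1 * \sum_i fine (agent_cost f (X f) i))%:E].
  exists (fun f => state f); split; last exact: JsocE.
  - by move=> f Uf; exact: stateP.
  - by move=> f Uf; exact: (state_sqint T_gt0 noise u_adm Uf (stateP T_gt0 A G B sigma noise u_adm Uf)).
rewrite -/J; move: J JE => J JE.
have Usub f g : U f -> U g -> U (fun t w => f t w - g t w).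
  move=> Uf Ug; have := admissible_comb 1 (-1) Uf Ug.
  rewrite (_ : (fun t w => _) = fun t w => f t w - g t w) //.
  by apply/funext => t; apply/funext => w; rewrite scale1r scaleN1r.
(* An equality of truth values: the convexity inequality at a given [lam] is the sign condition on
   the defect, so both directions rewrite with it. *)
have J_comb f g z lam : U f -> U g -> sqint P T z ->
    {ae P, forall w, forall t, 0 <= t <= T -> forall j, X f j t w - X g j t w = z t w} ->
    (J (fun t w => lam *: f t w + (1 - lam) *: g t w)%R
       <= lam%:E * J f + (1 - lam)%:E * J g)%E =
    (0 <= lam * (1 - lam) * fine (defect (fun t w => f t w - g t w) z)).
  move=> Uf Ug z2 xyz; have Uc := admissible_comb lam (1 - lam) Uf Ug.
  have mix := state_comb T_gt0 u_adm Uf Ug (fun _ _ => erefl) (Xs _ Uf) (Xs _ Ug) (Xs _ Uc).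
  rewrite !JE // -!EFinM -EFinD lee_fin.
  rewrite (eq_bigr _ (fun i _ => agent_cost_comb i (admissible_PL2 Uf) (admissible_PL2 Ug) z2
    (X2 _ Uf) (X2 _ Ug) (X2 _ Uc) mix xyz)).
  rewrite sumrB big_split /= -!mulr_sumr sumr_const card_ord.
  set a := \sum_i _; set b := \sum_i _; set e := fine _.
  rewrite -[e *+ N]mulr_natl -subr_ge0.
  rewrite (_ : _ - _ = 2^-1 * N%:R * (lam * (1 - lam) * e)); last by ring.
  by rewrite pmulr_rge0 // mulr_gt0.
have diff f g : U f -> U g -> exists2 z, mean_solution (fun t w => f t w - g t w) z &
    {ae P, forall w, forall t, 0 <= t <= T -> forall j, X f j t w - X g j t w = z t w}.
  move=> Uf Ug.
  have sd := state_diff T_gt0 u_adm Uf Ug (Xs _ Uf) (Xs _ Ug).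
  have [yy sz] := agents_collapse T_gt0 N_ge1 (admissible_pathL1 (Usub _ _ Uf Ug)) sd.
  exists (fun t w => X f i0 t w - X g i0 t w); first exact: sz.
  by apply: filterS yy => w yw t tT j; exact: yw.
split=> [cvx f Uf z sz|pos f g Uf Ug lam /andP[lam0 lam1]]; last first.
  have [z sz xz] := diff f g Uf Ug.
  have Ud := Usub _ _ Uf Ug.
  rewrite (J_comb f g z) //; last exact: (mean_sqint Ud sz).
  apply: mulr_ge0; first by rewrite mulr_ge0 // subr_ge0.
  by apply: fine_ge0; exact: (pos _ Ud _ sz).
have U0 : U (fun _ _ => 0) by exact: admissible0.
have [z' sz' xz'] := diff f _ Uf U0.
have E : (fun t w => f t w - 0) = f.
  by apply/funext => t; apply/funext => w; rewrite subr0.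
rewrite E in sz'.
(* The given [z] is arbitrary, while [z'] comes from the states for f and 0; uniqueness identifies
   them. *)
have zz' := solves_unique T_gt0 (admissible_pathL1 Uf) sz sz'.
have z2 := mean_sqint Uf sz.
have xz : {ae P, forall w, forall t, 0 <= t <= T ->
    forall j, X f j t w - X (fun _ _ => 0) j t w = z t w}.
  by apply: filterS2 zz' xz' => w Hz Hx t tT j; rewrite Hx // Hz.
(* A weight strictly between 0 and 1 makes lam (1 - lam) positive, so it can be cancelled. *)
have half : 0 <= (2^-1 : R) <= 1 by lra.
have := cvx f _ Uf U0 _ half.
rewrite (J_comb f _ z) // E -(fineK (defect_fin_num Uf z2)) lee_fin.
by rewrite pmulr_rge0 //; lra.
Qed.

End characterizations.

Theorem proposition2p1
  (R : realType) (disp : measure_display) (Omega : measurableType disp)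
  (P : probability Omega R)
  (T : R) (N n r d : nat)
  (A G Gam : 'M[R]_n) (B : 'M[R]_(n, r)) (sigma : 'M[R]_(n, d))
  (eta : 'cV[R]_n) (Q R2 H : 'M[R]_n)
  (x0 : 'I_N -> Omega -> 'cV[R]_n) (W : 'I_N -> process R Omega d)
  (u : 'I_N -> process R Omega r)
  (T_gt0 : 0 < T) (N_ge1 : (1 <= N)%N)
  (Q_psd : possemidef Q) (R2_pd : posdef R2) (H_psd : possemidef H)
  (noise : noise_model P x0 W)
  (u_adm : forall i, admissible P T x0 W (u i)) :
  let UcF : set (process R Omega n) := admissible P T x0 W (m := n) in
  let i_ :=
    convex_functional UcF (Jsoc P T A G Gam B sigma eta Q R2 H x0 W u) in
  let ii_ :=
    forall f, UcF f -> forall y : process R Omega (N * n),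
      solves P T (fun _ => 0)
        (fun t w => Acheck N A G *m y t w + ones_tens N (f t w))
        (fun _ _ => 0) y ->
      (0 <= Eint P T (fun t w => - qform (Qhat N Q Gam) (y t w)
                                 + N%:R * qform R2 (f t w))%R
            - \int[P]_w (qform (blkdiag N H) (y T w))%:E)%E in
  let iii_ :=
    forall f, UcF f -> forall y : 'I_N -> process R Omega n,
      (forall i, solves P T (fun _ => 0)
        (fun t w => A *m y i t w + G *m avg (fun j => y j t w) + f t w)
        (fun _ _ => 0) (y i)) ->
      forall i : 'I_N,
      (0 <= Eint P T (fun t w => - qform Q ((1%:M - Gam) *m y i t w)
                                 + qform R2 (f t w))%R
            - \int[P]_w (qform H (y i T w))%:E)%E in
  (i_ <-> ii_) /\ (ii_ <-> iii_).
Proof.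
move=> UcF i_ ii_ iii_.
have iP : i_ <-> mean_field_positivity P T A G Gam Q R2 H x0 W.
  exact: (convexityP T_gt0 N_ge1 A G Gam B sigma eta Q R2 H noise u_adm).
have iiP : ii_ <-> mean_field_positivity P T A G Gam Q R2 H x0 W.
  exact: (stacked_positivityP P T_gt0 N_ge1 A G Gam Q R2 H x0 W).
have iiiP : iii_ <-> mean_field_positivity P T A G Gam Q R2 H x0 W.
  exact: (agents_positivityP P T_gt0 N_ge1 A G Gam Q R2 H x0 W).
split.
exact: (iff_trans iP (iff_sym iiP)).
exact: (iff_trans iiP (iff_sym iiiP)).
Qed.
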